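(* Let $A$ be a left-symmetric conformal algebra which is free and of finite rank as a $\mathbb{C}[\partial]$-module. Let $\{e_1,\dots,e_n\}$ be a $\mathbb{C}[\partial]$-basis of $A$ and $\{e_1^*,\dots,e_n^*\}$ the dual $\mathbb{C}[\partial]$-basis of $A^{*c}$. Then $$r=\sum_{i=1}^n(e_i\otimes e_i^*-e_i^*\otimes e_i)$$ is a solution of the conformal classical Yang-Baxter equation in $\mathfrak{g}(A)\ltimes_{L_A^*}\mathfrak{g}(A)^{*c}$.
   Context: A left-symmetric conformal algebra is a $\mathbb{C}[\partial]$-module $A$ with a $\mathbb{C}$-bilinear map $A\times A\to A[\lambda]$, $(a,b)\mapsto a_\lambda b$, such that $(\partial a)_\lambda b=-\lambda a_\lambda b$, $a_\lambda(\partial b)=(\partial+\lambda)a_\lambda b$ and $(a_\lambda b)_{\lambda+\mu}c-a_\lambda(b_\mu c)=(b_\mu a)_{\lambda+\mu}c-b_\mu(a_\lambda c)$. Its sub-adjacent Lie conformal algebra $\mathfrak{g}(A)$ is the $\mathbb{C}[\partial]$-module $A$ with $[a_\lambda b]=a_\lambda b-b_{-\lambda-\partial}a$. Here and below substituting $-\lambda-\partial$ for $\lambda$ in $\sum_n\lambda^nc_n$ means $\sum_n(-\lambda-\partial)^nc_n$, with $\partial$ acting on the coefficients. A Lie conformal algebra is a $\mathbb{C}[\partial]$-module with a bilinear $\lambda$-bracket satisfying $[\partial a_\lambda b]=-\lambda[a_\lambda b]$, $[a_\lambda\partial b]=(\partial+\lambda)[a_\lambda b]$, $[a_\lambda b]=-[b_{-\lambda-\partial}a]$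 and $[a_\lambda[b_\mu c]]=[[a_\lambda b]_{\lambda+\mu}c]+[b_\mu[a_\lambda c]]$. The conformal dual $A^{*c}=\mathfrak{g}(A)^{*c}$ is the set of $\mathbb{C}$-linear maps $f_\lambda:A\to\mathbb{C}[\lambda]$ with $f_\lambda(\partial a)=\lambda f_\lambda(a)$, with $(\partial f)_\lambda=-\lambda f_\lambda$; the dual basis satisfies $(e_i^* )_\lambda(e_k)=\delta_{ik}$. The regular representation $L_A$ of $\mathfrak{g}(A)$ on $A$ is $L_A(a)_\lambda b=a_\lambda b$, and its dual $L_A^*$ on $A^{*c}$ is $(L_A^*(a)_\lambda f)_\mu b=-f_{\mu-\lambda}(a_\lambda b)$. The Lie conformal algebra $L=\mathfrak{g}(A)\ltimes_{L_A^*}\mathfrak{g}(A)^{*c}$ is the $\mathbb{C}[\partial]$-module $A\oplus A^{*c}$ with $[(a+f)_\lambda(b+g)]=[a_\lambda b]+L_A^*(a)_\lambda g-L_A^*(b)_{-\lambda-\partial}f$. The conformal classical Yang-Baxter equation for $r=\sum_i x_i\otimes y_i$ in a Lie conformal algebra $L$ is $$\sum_{i,j}\big([{x_i}_\mu x_j]\otimes y_i\otimes y_j|_{\mu=1\otimes\partial\otimes1}-x_i\otimes[{x_j}_\mu y_i]\otimes y_j|_{\mu=1\otimes1\otimes\partial}-x_i\otimes x_j\otimes[{y_j}_\mu y_i]|_{\mu=1\otimes\partial\otimes1}\big)=0 \mod (\partial^{\otimes^3})$$ in $L\otimes L\otimes L$ (tensor products over $\mathbb{C}$), where $\partial^{\otimes^3}=\partial\otimes1\otimes1+1\otimes\partial\otimes1+1\otimes1\otimes\partial$,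 ''mod $(\partial^{\otimes^3})$'' means modulo $\partial^{\otimes^3}(L\otimes L\otimes L)$, and the subscript means each power $\mu^n$ is replaced by the $n$-th power of the indicated operator. *)

(* Defs.v *)
From HB Require Import structures.
From mathcomp Require Import all_boot all_algebra.
From mathcomp Require Import generic_quotient ring_quotient.
From mathcomp Require Import finmap boolp classical_sets.
From mathcomp Require Import monalg.

Set Implicit Arguments.
Unset Strict Implicit.
Unset Printing Implicit Defensive.

Import GRing.Theory.
Local Open Scope ring_scope.
Local Open Scope quotient_scope.

(* M[lambda]; the element lambda^n c is [lmon c n].  If M is an S-module then
   M[lambda] is a module over S[lambda] = {poly S}. *)
Definition lpoly (M : zmodType) : Type := {malg M[nat]}.

HB.instance Definition _ (M : zmodType) := GRing.Zmodule.on (lpoly M).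

Definition lmon (M : zmodType) (c : M) (n : nat) : lpoly M := << c *g n >>.
Definition lconst (M : zmodType) (c : M) : lpoly M := lmon c 0.
Definition lcoef (M : zmodType) (f : lpoly M) (n : nat) : M := mcoeff n f.
Definition lsupp (M : zmodType) (f : lpoly M) : {fset nat} := msupp f.

(* sum_n lambda^n c_n |-> sum_n D^n (phi c_n), that is, substitution of the
   operator D for lambda, the coefficients being mapped to N by phi. *)
Definition subst (M N : zmodType) (D : N -> N) (phi : M -> N) (f : lpoly M) : N :=
  \sum_(k <- lsupp f) iter k D (phi (lcoef f k)).

Section LpolyTheory.
Variable M : zmodType.
Implicit Types (f g : lpoly M) (c : M).

Lemma lpolyP f g : (forall n, lcoef f n = lcoef g n) -> f = g.
Proof. by move=> h; apply/malgP. Qed.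

Lemma lcoef0 n : lcoef (0 : lpoly M) n = 0. Proof. exact: mcoeff0. Qed.
Lemma lcoefD f g n : lcoef (f + g) n = lcoef f n + lcoef g n.
Proof. exact: mcoeffD. Qed.
Lemma lcoefN f n : lcoef (- f) n = - lcoef f n. Proof. exact: mcoeffN. Qed.
Lemma lcoef_sum I (r : seq I) (P : pred I) (F : I -> lpoly M) n :
  lcoef (\sum_(i <- r | P i) F i) n = \sum_(i <- r | P i) lcoef (F i) n.
Proof. exact: (raddf_sum (mcoeff n)). Qed.

Lemma lcoef_mon c n m : lcoef (lmon c n) m = c *+ (n == m).
Proof. exact: mcoeffU. Qed.

Lemma lmonE f : f = \sum_(k <- lsupp f) lmon (lcoef f k) k.
Proof. exact: monalgE. Qed.

Lemma lcoef_notin f n : n \notin lsupp f -> lcoef f n = 0.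
Proof. exact: mcoeff_outdom. Qed.

Section Subst.
Variables (N : zmodType) (D : N -> N) (phi : M -> N).
Hypotheses (DB : zmod_morphism D) (phiB : zmod_morphism phi).

Let D0 : D 0 = 0. Proof. by have := DB 0 0; rewrite !subrr. Qed.
Let phi0 : phi 0 = 0. Proof. by have := phiB 0 0; rewrite !subrr. Qed.
Let DD x y : D (x + y) = D x + D y.
Proof. by apply/eqP; rewrite -subr_eq -DB addrK. Qed.
Let phiD c d : phi (c + d) = phi c + phi d.
Proof. by apply/eqP; rewrite -subr_eq -phiB addrK. Qed.

Lemma iterD0 k : iter k D 0 = 0.
Proof. by elim: k => //= k ->. Qed.

Lemma iterDD k x y : iter k D (x + y) = iter k D x + iter k D y.
Proof. by elim: k => //= k ->. Qed.

Lemma substEw f (d : {fset nat}) : (lsupp f `<=` d)%fset ->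
  subst D phi f = \sum_(k <- d) iter k D (phi (lcoef f k)).
Proof.
move=> le_fd; rewrite /subst; apply: big_fset_incl => // k _ /lcoef_notin ->.
by rewrite phi0 iterD0.
Qed.

Lemma substD f g : subst D phi (f + g) = subst D phi f + subst D phi g.
Proof.
rewrite (substEw (msuppD_le f g)).
rewrite (substEw (fsubsetUl (lsupp f) (lsupp g))).
rewrite (substEw (fsubsetUr (lsupp f) (lsupp g))) -big_split /=.
by apply: eq_bigr => k _; rewrite lcoefD phiD iterDD.
Qed.

Lemma subst0 : subst D phi 0 = 0.
Proof. by rewrite /subst [lsupp _]msupp0 big_seq_fset0. Qed.

Lemma subst_mon c n : subst D phi (lmon c n) = iter n D (phi c).
Proof.
rewrite (substEw (msuppU_le : (lsupp (lmon c n) `<=` [fset n])%fset)).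
by rewrite big_seq_fset1 lcoef_mon eqxx.
Qed.

Lemma substB f g : subst D phi (f - g) = subst D phi f - subst D phi g.
Proof. by apply/eqP; rewrite -[_ == _]subr_eq opprK -substD addrNK. Qed.

End Subst.
End LpolyTheory.

Section LpolyModule.
Variables (S : nzRingType) (M : lmodType S).
Implicit Types (p q : {poly S}) (f g : lpoly M).

Definition lpoly_scale p f : lpoly M :=
  \sum_(i < size p) \sum_(k <- lsupp f) lmon (p`_i *: lcoef f k) (i + k).

Lemma lpoly_scaleE p f n :
  lcoef (lpoly_scale p f) n = \sum_(i < n.+1) p`_i *: lcoef f (n - i).
Proof.
rewrite lcoef_sum.
have E (i : nat) : lcoef (\sum_(k <- lsupp f) lmon (p`_i *: lcoef f k) (i + k)) n
  = if (i <= n)%N then p`_i *: lcoef f (n - i) else 0.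
  rewrite lcoef_sum; under eq_bigr do rewrite lcoef_mon.
  case: leqP => [le_in|lt_ni]; last first.
    rewrite big1_seq // => k _; case: eqP => // e.
    by move: lt_ni; rewrite -e ltnNge leq_addr.
  rewrite [in RHS](lmonE f) lcoef_sum scaler_sumr; apply: eq_bigr => k _.
  rewrite lcoef_mon -scalerMnr; congr (_ *+ _).
  by rewrite -{1}(subnKC le_in) eqn_add2l.
under eq_bigr do rewrite E.
rewrite -(big_mkord xpredT (fun i => if (i <= n)%N then p`_i *: lcoef f (n - i) else 0)).
rewrite -(big_mkord xpredT (fun i => p`_i *: lcoef f (n - i))).
pose m := maxn (size p) n.+1.
transitivity (\sum_(0 <= i < m) if (i <= n)%N then p`_i *: lcoef f (n - i) else 0).
  rewrite [RHS](big_cat_nat _ (n := size p)) ?leq_maxl //=.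
  rewrite [X in _ + X]big_nat_cond [X in _ + X]big1 ?addr0 // => i /andP[/andP[le_pi _] _].
  by rewrite nth_default // scale0r if_same.
rewrite (big_cat_nat _ (n := n.+1)) ?leq_maxr //=.
rewrite [X in _ + X]big_nat_cond [X in _ + X]big1 ?addr0; last first.
  by move=> i /andP[/andP[lt_ni _] _]; rewrite leqNgt lt_ni.
by rewrite !big_mkord; apply: eq_bigr => i _; rewrite -ltnS ltn_ord.
Qed.

Lemma lpoly_scaleA p q f :
  lpoly_scale p (lpoly_scale q f) = lpoly_scale (p * q) f.
Proof.
apply: lpolyP => n; rewrite !lpoly_scaleE.
pose coef3 j k := p`_j *: (q`_(n - j - k) *: lcoef f k).
transitivity (\sum_(j < n.+1) \sum_(k < n.+1 | (k <= n - j)%N) coef3 j k).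
  apply: eq_bigr => /= j _; rewrite lpoly_scaleE scaler_sumr.
  rewrite (big_ord_narrow_leq (leq_subr _ _)) /coef3 /=.
  rewrite (reindex_inj rev_ord_inj) /=; apply: eq_bigr => k _.
  by rewrite subSS subKn // -ltnS.
rewrite (exchange_big_dep predT) //= [RHS](reindex_inj rev_ord_inj) /=.
apply: eq_bigr => k _; rewrite subSS subKn -1?ltnS //.
transitivity (\sum_(j < n.+1 | (j <= n - k)%N) coef3 j k).
  apply: eq_bigl => j; rewrite -ltnS -(ltnS j) -!subSn ?leq_ord //.
  by rewrite -subn_gt0 -(subn_gt0 j) -!subnDA addnC.
rewrite (big_ord_narrow_leq (leq_subr _ _)) coefM scaler_suml /=.
by apply: eq_bigr => j _; rewrite /coef3 -!subnDA addnC scalerA.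
Qed.

Lemma lpoly_scale1 : left_id 1 lpoly_scale.
Proof.
move=> f; apply: lpolyP => n; rewrite lpoly_scaleE big_ord_recl subn0 coef1 scale1r.
by rewrite big1 ?addr0 // => i _; rewrite coef1 scale0r.
Qed.

Lemma lpoly_scaleDr : right_distributive lpoly_scale +%R.
Proof.
move=> p f g; apply: lpolyP => n; rewrite lcoefD !lpoly_scaleE -big_split /=.
by apply: eq_bigr => i _; rewrite lcoefD scalerDr.
Qed.

Lemma lpoly_scaleDl f : {morph lpoly_scale^~ f : p q / p + q}.
Proof.
move=> p q; apply: lpolyP => n; rewrite lcoefD !lpoly_scaleE -big_split /=.
by apply: eq_bigr => i _; rewrite coefD scalerDl.
Qed.

HB.instance Definition _ := GRing.Zmodule_isLmodule.Build {poly S} (lpoly M)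
  lpoly_scaleA lpoly_scale1 lpoly_scaleDr lpoly_scaleDl.

Lemma lcoefZ p f n :
  lcoef (p *: f) n = \sum_(i < n.+1) p`_i *: lcoef f (n - i).
Proof. exact: lpoly_scaleE. Qed.

Lemma lscaleC (s : S) (c : M) n : s%:P *: lmon c n = lmon (s *: c) n.
Proof.
apply: lpolyP => m; rewrite lcoefZ big_ord_recl subn0 coefC /= lcoef_mon.
rewrite big1 ?addr0 => [|i _]; last by rewrite coefC scale0r.
by rewrite lcoef_mon -scalerMnr.
Qed.

Lemma lscaleX (c : M) n : 'X *: lmon c n = lmon c n.+1.
Proof.
apply: lpolyP => m; rewrite lcoefZ lcoef_mon.
case: m => [|m].
  by rewrite big_ord1 coefX scale0r.
rewrite big_ord_recl big_ord_recl coefX scale0r add0r coefX scale1r lcoef_mon.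
rewrite big1 ?addr0 => [|i _]; last by rewrite coefX scale0r.
by rewrite /= subSS subn0 eqSS.
Qed.

End LpolyModule.

Section Tensor.
Variables (K : fieldType) (U V : lmodType K).

Local Notation freeUV := {malg K[(U * V)%type]}.

Definition tgen (u : U) (v : V) : freeUV := << 1 *g (u, v) >>.

Inductive tensor_rel : freeUV -> Prop :=
| tensor_rel0 : tensor_rel 0
| tensor_relD t t' : tensor_rel t -> tensor_rel t' -> tensor_rel (t + t')
| tensor_relZ c t : tensor_rel t -> tensor_rel (c *: t)
| tensor_rel_addl u u' v : tensor_rel (tgen (u + u') v - tgen u v - tgen u' v)
| tensor_rel_addr u v v' : tensor_rel (tgen u (v + v') - tgen u v - tgen u v')
| tensor_rel_scalel c u v : tensor_rel (tgen (c *: u) v - c *: tgen u v)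
| tensor_rel_scaler c u v : tensor_rel (tgen u (c *: v) - c *: tgen u v).

Definition tensor_ideal : {pred freeUV} := fun t => `[< tensor_rel t >].

Lemma tensor_ideal_zmod_closed : zmod_closed tensor_ideal.
Proof.
split=> [|x y]; rewrite /in_mem /=; first by apply/asboolP; exact: tensor_rel0.
move=> /asboolP hx /asboolP hy; apply/asboolP; rewrite -[- y]scaleN1r.
by apply: tensor_relD => //; apply: tensor_relZ.
Qed.

HB.instance Definition _ :=
  GRing.isZmodClosed.Build freeUV tensor_ideal tensor_ideal_zmod_closed.

Definition tensor : Type := @Quotient.quot freeUV tensor_ideal.

HB.instance Definition _ := GRing.Zmodule.on tensor.

Definition tproj (t : freeUV) : tensor := \pi_(@Quotient.quot freeUV tensor_ideal) t.
Definition trepr (t : tensor) : freeUV := repr (t : @Quotient.quot freeUV tensor_ideal).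

Lemma treprK : cancel trepr tproj. Proof. by move=> t; rewrite /tproj reprK. Qed.

Lemma tprojP t t' : tproj t = tproj t' <-> tensor_rel (t - t').
Proof.
have /= E := @Quotient.idealrBE _ tensor_ideal t t'.
split=> [e|h]; first by apply/asboolP; have -> : `[< tensor_rel (t - t') >] = (t - t' \in tensor_ideal) by []; rewrite E; apply/eqP.
by apply/eqP; rewrite -E; apply/asboolP.
Qed.

Lemma tprojD t t' : tproj (t + t') = tproj t + tproj t'.
Proof. exact: (raddfD \pi_(@Quotient.quot freeUV tensor_ideal)). Qed.

Definition tensor_scale (c : K) (t : tensor) : tensor := tproj (c *: trepr t).

Lemma tproj_scale c t : tproj (c *: t) = tensor_scale c (tproj t).
Proof.
apply/tprojP; rewrite -scalerBr; apply: tensor_relZ; apply/tprojP.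
by rewrite treprK.
Qed.

Lemma tensor_scaleA a b t :
  tensor_scale a (tensor_scale b t) = tensor_scale (a * b) t.
Proof. by rewrite -[t]treprK -!tproj_scale scalerA. Qed.

Lemma tensor_scale1 : left_id 1 tensor_scale.
Proof. by move=> t; rewrite -[t]treprK -!tproj_scale scale1r. Qed.

Lemma tensor_scaleDr : right_distributive tensor_scale +%R.
Proof.
move=> c t t'; rewrite -[t]treprK -[t']treprK.
by rewrite -tprojD -!tproj_scale -tprojD scalerDr.
Qed.

Lemma tensor_scaleDl t : {morph tensor_scale^~ t : a b / a + b}.
Proof. by move=> a b; rewrite -[t]treprK -!tproj_scale -tprojD scalerDl. Qed.

HB.instance Definition _ := GRing.Zmodule_isLmodule.Build K tensor
  tensor_scaleA tensor_scale1 tensor_scaleDr tensor_scaleDl.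

Definition tpure (u : U) (v : V) : tensor := tproj (tgen u v).

Lemma tprojZ c t : tproj (c *: t) = c *: tproj t.
Proof. exact: tproj_scale. Qed.

Lemma tprojB t t' : tproj (t - t') = tproj t - tproj t'.
Proof. by rewrite tprojD -scaleN1r tprojZ scaleN1r. Qed.

Lemma tpureDl u u' v : tpure (u + u') v = tpure u v + tpure u' v.
Proof.
rewrite /tpure -tprojD; apply/tprojP; rewrite opprD addrA.
exact: tensor_rel_addl.
Qed.

Lemma tpureDr u v v' : tpure u (v + v') = tpure u v + tpure u v'.
Proof.
rewrite /tpure -tprojD; apply/tprojP; rewrite opprD addrA.
exact: tensor_rel_addr.
Qed.

Lemma tpureZl c u v : tpure (c *: u) v = c *: tpure u v.
Proof. by rewrite /tpure -tprojZ; apply/tprojP; exact: tensor_rel_scalel. Qed.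

Lemma tpureZr c u v : tpure u (c *: v) = c *: tpure u v.
Proof. by rewrite /tpure -tprojZ; apply/tprojP; exact: tensor_rel_scaler. Qed.

Definition free_lift (W : lmodType K) (h : U -> V -> W) (t : freeUV) : W :=
  \sum_(k <- msupp t) t@_k *: h k.1 k.2.

(* The map out of the tensor product induced by h; meaningful when h is
   bilinear, see [tliftE]. *)
Definition tlift (W : lmodType K) (h : U -> V -> W) (t : tensor) : W :=
  free_lift h (trepr t).

Section Lift.
Variables (W : lmodType K) (h : U -> V -> W).

Lemma free_liftEw t (d : {fset (U * V)%type}) : (msupp t `<=` d)%fset ->
  free_lift h t = \sum_(k <- d) t@_k *: h k.1 k.2.
Proof.
move=> le_td; apply: big_fset_incl => // k _ /mcoeff_outdom ->.
by rewrite scale0r.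
Qed.

Lemma free_liftD t t' : free_lift h (t + t') = free_lift h t + free_lift h t'.
Proof.
rewrite (free_liftEw (msuppD_le t t')).
rewrite (free_liftEw (fsubsetUl (msupp t) (msupp t'))).
rewrite (free_liftEw (fsubsetUr (msupp t) (msupp t'))) -big_split /=.
by apply: eq_bigr => k _; rewrite mcoeffD scalerDl.
Qed.

Lemma free_liftZ c t : free_lift h (c *: t) = c *: free_lift h t.
Proof.
rewrite (free_liftEw (msuppZ_le c t)) /free_lift scaler_sumr.
by apply: eq_bigr => k _; rewrite mcoeffZ scalerA.
Qed.

Lemma free_liftB t t' : free_lift h (t - t') = free_lift h t - free_lift h t'.
Proof. by rewrite free_liftD -[- t']scaleN1r free_liftZ scaleN1r. Qed.

Lemma free_lift_gen u v : free_lift h (tgen u v) = h u v.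
Proof.
rewrite (free_liftEw (msuppU_le : (msupp (tgen u v) `<=` [fset (u, v)])%fset)).
by rewrite big_seq_fset1 mcoeffUU scale1r.
Qed.

Hypothesis h_linl : forall v, linear (h^~ v).
Hypothesis h_linr : forall u, linear (h u).

Lemma free_lift_rel t : tensor_rel t -> free_lift h t = 0.
Proof.
elim=> {t} [|t t' _ ht _ ht'|c t _ ht|u u' v|u v v'|c u v|c u v].
- by rewrite /free_lift msupp0 big_seq_fset0.
- by rewrite free_liftD ht ht' addr0.
- by rewrite free_liftZ ht scaler0.
- rewrite !free_liftB !free_lift_gen -[u]scale1r h_linl !scale1r.
  by rewrite addrAC addrK subrr.
- rewrite !free_liftB !free_lift_gen -[v]scale1r h_linr !scale1r.
  by rewrite addrAC addrK subrr.
- have h0 : h 0 v = 0.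
    by have := h_linl v (-1) 0 0; rewrite scaler0 addr0 scaleN1r addNr.
  by rewrite free_liftB free_liftZ !free_lift_gen -[_ *: u]addr0 h_linl h0 addr0 subrr.
- have h0 : h u 0 = 0.
    by have := h_linr u (-1) 0 0; rewrite scaler0 addr0 scaleN1r addNr.
  by rewrite free_liftB free_liftZ !free_lift_gen -[_ *: v]addr0 h_linr h0 addr0 subrr.
Qed.

Lemma tlift_proj t : tlift h (tproj t) = free_lift h t.
Proof.
apply/eqP; rewrite -subr_eq0 -free_liftB; apply/eqP/free_lift_rel.
by apply/tprojP; rewrite treprK.
Qed.

Lemma tliftE u v : tlift h (tpure u v) = h u v.
Proof. by rewrite tlift_proj free_lift_gen. Qed.

Lemma tlift_linear : linear (tlift h).
Proof.
move=> c t t'; rewrite -[t]treprK -[t']treprK -tprojZ -tprojD !tlift_proj.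
by rewrite free_liftD free_liftZ.
Qed.

End Lift.
End Tensor.

Definition tmap (K : fieldType) (U V U' V' : lmodType K)
    (f : U -> U') (g : V -> V') : tensor U V -> tensor U' V' :=
  tlift (fun u v => tpure (f u) (g v)).

Section TensorMap.
Variables (K : fieldType) (U V U' V' : lmodType K).
Variables (f : U -> U') (g : V -> V').
Hypotheses (fP : linear f) (gP : linear g).

Let tmap_linl v : linear (fun u => tpure (f u) (g v)).
Proof. by move=> c x y; rewrite fP tpureDl tpureZl. Qed.
Let tmap_linr u : linear (fun v => tpure (f u) (g v)).
Proof. by move=> c x y; rewrite gP tpureDr tpureZr. Qed.

Lemma tmapE u v : tmap f g (tpure u v) = tpure (f u) (g v).
Proof. exact: tliftE. Qed.

Lemma tmap_linear : linear (tmap f g).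
Proof. exact: tlift_linear. Qed.

End TensorMap.

Section RestrictScalars.
Variables (K : fieldType) (M : lmodType {poly K}).

(* M with scalars restricted to K; a separate name since M keeps its own
   module structure over {poly K}. *)
Definition kspace : Type := M.

HB.instance Definition _ := GRing.Zmodule.on kspace.

Definition kspace_scale (c : K) (x : kspace) : kspace := c%:P *: (x : M).

Lemma kspace_scaleA a b x :
  kspace_scale a (kspace_scale b x) = kspace_scale (a * b) x.
Proof. by rewrite /kspace_scale scalerA polyCM. Qed.
Lemma kspace_scale1 : left_id 1 kspace_scale.
Proof. by move=> x; rewrite /kspace_scale scale1r. Qed.
Lemma kspace_scaleDr : right_distributive kspace_scale +%R.
Proof. by move=> c x y; exact: scalerDr. Qed.
Lemma kspace_scaleDl x : {morph kspace_scale^~ x : a b / a + b}.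
Proof. by move=> a b; rewrite /kspace_scale polyCD scalerDl. Qed.

HB.instance Definition _ := GRing.Zmodule_isLmodule.Build K kspace
  kspace_scaleA kspace_scale1 kspace_scaleDr kspace_scaleDl.

Definition kpartial (x : kspace) : kspace := 'X *: (x : M).

Lemma kpartial_linear : linear kpartial.
Proof.
move=> c x y; rewrite /kpartial scalerDr; congr (_ + _).
by rewrite [RHS]scalerA [LHS]scalerA mulrC.
Qed.

HB.instance Definition _ :=
  GRing.isLinear.Build K kspace kspace _ kpartial kpartial_linear.

End RestrictScalars.

(* Conformal algebras.  A K[d]-module is an lmodType over {poly K}, with d
   acting as 'X.  Consequently
   - over M[lambda], d is 'X%:P and lambda is 'X;
   - over M[lambda][mu], d is 'X%:P%:P, lambda is 'X%:P and mu is 'X. *)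

Section LeftSymmetric.
Variables (K : fieldType) (A : lmodType {poly K}) (prod : A -> A -> lpoly A).

(* prod_at x a b is a_x b in A[lambda][mu], for x in K[d][lambda][mu] *)
Definition prod_at (x : {poly {poly {poly K}}}) (a b : A) : lpoly (lpoly A) :=
  subst ( *:%R x) (fun c => lconst (lconst c)) (prod a b).

Local Notation lambda := ('X%:P : {poly {poly {poly K}}}).
Local Notation mu := ('X : {poly {poly {poly K}}}).

Record left_symmetric_conformal : Prop := LeftSymmetricConformal {
  lsc_linearl : forall c a a' b,
    prod (c%:P *: a + a') b = c%:P%:P *: prod a b + prod a' b;
  lsc_linearr : forall c a b b',
    prod a (c%:P *: b + b') = c%:P%:P *: prod a b + prod a b';
  lsc_partiall : forall a b, prod ('X *: a) b = - 'X *: prod a b;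
  lsc_partialr : forall a b, prod a ('X *: b) = ('X%:P + 'X) *: prod a b;
  lsc_symmetric : forall a b c,
    subst ( *:%R lambda) (fun u => prod_at (lambda + mu) u c) (prod a b)
    - subst ( *:%R mu) (fun v => prod_at lambda a v) (prod b c)
    = subst ( *:%R mu) (fun u => prod_at (lambda + mu) u c) (prod b a)
      - subst ( *:%R lambda) (fun v => prod_at mu b v) (prod a c)
}.

End LeftSymmetric.

(* f(lambda) |-> f(- lambda - d) *)
Definition lambda_flip (K : fieldType) (M : lmodType {poly K}) (f : lpoly M) : lpoly M :=
  subst ( *:%R (- 'X - 'X%:P : {poly {poly K}})) (@lconst M) f.

Definition lpoly_map (M N : zmodType) (phi : M -> N) (f : lpoly M) : lpoly N :=
  \sum_(k <- lsupp f) lmon (phi (lcoef f k)) k.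

Definition subadjacent (K : fieldType) (A : lmodType {poly K})
    (prod : A -> A -> lpoly A) (a b : A) : lpoly A :=
  prod a b - lambda_flip (prod b a).

(* The bracket [(a+f)_lambda (b+g)]
   = [a_lambda b] + rho(a)_lambda g - rho(b)_{- lambda - d} f on A (+) V. *)
Definition semidirect (K : fieldType) (A V : lmodType {poly K})
    (br : A -> A -> lpoly A) (rho : A -> V -> lpoly V)
    (x y : (A * V)%type) : lpoly (A * V)%type :=
  lpoly_map (fun a => (a, 0)) (br x.1 y.1)
  + lpoly_map (fun f => (0, f)) (rho x.1 y.2 - lambda_flip (rho y.1 x.2)).

Section Dual.
Variables (K : fieldType) (A : lmodType {poly K}).

Definition conformal_linear (f : A -> {poly K}) : Prop :=
  (forall c a b, f (c%:P *: a + b) = c *: f a + f b)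
  /\ (forall a, f ('X *: a) = 'X * f a).

Record cdual := Cdual {
  cdual_fun :> A -> {poly K};
  cdualP : conformal_linear cdual_fun
}.

HB.instance Definition _ := gen_eqMixin cdual.
HB.instance Definition _ := gen_choiceMixin cdual.

Lemma cdual_ext (f g : cdual) : (forall a, f a = g a) -> f = g.
Proof.
case: f g => [f hf] [g hg] /= /funext e; case: _ / e in hg *.
by congr Cdual; exact: Prop_irrelevance.
Qed.

Fact cdual_zero_subproof : conformal_linear (fun=> 0).
Proof. by split=> *; rewrite ?scaler0 ?addr0 ?mulr0. Qed.
Fact cdual_opp_subproof (f : cdual) : conformal_linear (fun a => - f a).
Proof.
case: f => f [fl fd]; split=> /= *; last by rewrite fd mulrN.
by rewrite fl opprD scalerN.
Qed.
Fact cdual_add_subproof (f g : cdual) : conformal_linear (fun a => f a + g a).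
Proof.
case: f g => f [fl fd] [g [gl gd]]; split=> /= *; last by rewrite fd gd mulrDr.
by rewrite fl gl scalerDr addrACA.
Qed.
Fact cdual_scale_subproof (p : {poly K}) (f : cdual) :
  conformal_linear (fun a => (p \Po (- 'X)) * f a).
Proof.
case: f => f [fl fd]; split=> /= *; last by rewrite fd mulrCA.
by rewrite fl mulrDr scalerAr.
Qed.

Definition cdual_zero := Cdual cdual_zero_subproof.
Definition cdual_opp f := Cdual (cdual_opp_subproof f).
Definition cdual_add f g := Cdual (cdual_add_subproof f g).
(* (d f)_lambda = - lambda f_lambda *)
Definition cdual_scale p f := Cdual (cdual_scale_subproof p f).

Fact cdual_addA : associative cdual_add.
Proof. by move=> f g h; apply: cdual_ext => a /=; rewrite addrA. Qed.
Fact cdual_addC : commutative cdual_add.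
Proof. by move=> f g; apply: cdual_ext => a /=; rewrite addrC. Qed.
Fact cdual_add0 : left_id cdual_zero cdual_add.
Proof. by move=> f; apply: cdual_ext => a /=; rewrite add0r. Qed.
Fact cdual_addN : left_inverse cdual_zero cdual_opp cdual_add.
Proof. by move=> f; apply: cdual_ext => a /=; rewrite addNr. Qed.

HB.instance Definition _ :=
  GRing.isZmodule.Build cdual cdual_addA cdual_addC cdual_add0 cdual_addN.

Fact cdual_scaleA p q f :
  cdual_scale p (cdual_scale q f) = cdual_scale (p * q) f.
Proof. by apply: cdual_ext => a /=; rewrite comp_polyM mulrA. Qed.
Fact cdual_scale1 : left_id 1 cdual_scale.
Proof. by move=> f; apply: cdual_ext => a /=; rewrite comp_polyC mul1r. Qed.
Fact cdual_scaleDr : right_distributive cdual_scale +%R.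
Proof. by move=> p f g; apply: cdual_ext => a /=; rewrite mulrDr. Qed.
Fact cdual_scaleDl f : {morph cdual_scale^~ f : p q / p + q}.
Proof. by move=> p q; apply: cdual_ext => a /=; rewrite comp_polyD mulrDl. Qed.

HB.instance Definition _ := GRing.Zmodule_isLmodule.Build {poly K} cdual
  cdual_scaleA cdual_scale1 cdual_scaleDr cdual_scaleDl.

Lemma cdual_partialE (f : cdual) a : ('X *: f) a = - 'X * f a.
Proof. by rewrite /= comp_polyX. Qed.

Definition module_basis n (e : 'I_n -> A) : Prop :=
  (forall a, exists c : 'I_n -> {poly K}, a = \sum_i c i *: e i)
  /\ (forall c : 'I_n -> {poly K}, \sum_i c i *: e i = 0 -> forall i, c i = 0).

Definition dual_family n (e : 'I_n -> A) (es : 'I_n -> cdual) : Prop :=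
  forall i k, es i (e k) = (i == k)%:R.

(* Values of functionals are polynomials in lambda and mu: elements of
   {poly {poly K}}, with mu the inner variable and lambda the outer one. *)

(* F_mu b for F in A^{*c}[lambda] *)
Definition cdual_apply (F : lpoly cdual) (b : A) : {poly {poly K}} :=
  subst ( *%R 'X) (fun f : cdual => (f b)%:P) F.

(* q(mu - lambda) *)
Definition shift_var (q : {poly K}) : {poly {poly K}} :=
  (map_poly (fun c => c%:P%:P) q).['X%:P - 'X].

(* f_{mu - lambda}(u) for u in A[lambda] *)
Definition cdual_shift (f : cdual) (u : lpoly A) : {poly {poly K}} :=
  subst ( *%R 'X) (fun v => shift_var (f v)) u.

Variable prod : A -> A -> lpoly A.

(* (L_A^*(a)_lambda f)_mu b = - f_{mu - lambda}(a_lambda b).  There is at most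
   one such element of A^{*c}[lambda], and it exists as soon as A is finitely
   generated: see [cdual_apply_inj] and [dual_regularE]. *)
Definition dual_regular (a : A) (f : cdual) : lpoly cdual :=
  xget 0 [set F | forall b, cdual_apply F b = - cdual_shift f (prod a b)]%classic.

Lemma iter_mulX (R : nzRingType) (x y : R) k : iter k ( *%R x) y = x ^+ k * y.
Proof. by elim: k => [|k IH] /=; rewrite ?mul1r // IH exprS mulrA. Qed.

Lemma cdual_sum I (r : seq I) (F : I -> cdual) b :
  (\sum_(i <- r) F i) b = \sum_(i <- r) F i b.
Proof. by elim/big_ind2: _ => // f x g y /= -> ->. Qed.

Lemma coef_cdual_apply F b n : (cdual_apply F b)`_n = lcoef F n b.
Proof.
rewrite /cdual_apply /subst coef_sum.
transitivity (\sum_(k <- lsupp F) lcoef F k b *+ (k == n)).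
  apply: eq_bigr => k _; rewrite iter_mulX coefXnM coefC.
  by case: (ltngtP k n) => [lt_kn||->]; rewrite ?subnn // subn_eq0 leqNgt lt_kn.
case: (boolP (n \in lsupp F)) => [nF|nF].
  rewrite (big_fsetD1 n) //= eqxx big1_seq ?addr0 // => k /andP[_].
  by rewrite in_fsetD1 => /andP[/negbTE->].
rewrite (lcoef_notin nF) big1_seq //= => k kF.
by case: eqP => // e; rewrite e (negbTE nF) in kF.
Qed.

Lemma cdual_apply_inj F G :
  (forall b, cdual_apply F b = cdual_apply G b) -> F = G.
Proof.
move=> h; apply: lpolyP => n; apply: cdual_ext => b.
by rewrite -!coef_cdual_apply h.
Qed.

Lemma shift_varM p q : shift_var (p * q) = shift_var p * shift_var q.
Proof.
have -> u : shift_var u = (map_poly (polyC \o polyC) u).['X%:P - 'X] by [].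
by rewrite rmorphM hornerM.
Qed.

Lemma shift_varB : zmod_morphism shift_var.
Proof.
move=> p q; rewrite /shift_var -[fun _ => _]/(polyC \o polyC).
by rewrite rmorphB hornerD hornerN.
Qed.

Lemma shift_varX : shift_var 'X = 'X%:P - 'X.
Proof.
by rewrite /shift_var -[fun _ => _]/(polyC \o polyC) map_polyX hornerX.
Qed.

Lemma shift_varC c : shift_var c%:P = c%:P%:P.
Proof.
by rewrite /shift_var -[fun _ => _]/(polyC \o polyC) map_polyC hornerC.
Qed.

Section Existence.
Hypothesis prodP : left_symmetric_conformal prod.
Variables (n : nat) (e : 'I_n -> A).
Hypothesis e_span :
  forall a, exists c : 'I_n -> {poly K}, a = \sum_i c i *: e i.
Variables (a : A) (f : cdual).


Lemma cdualB (g : cdual) : zmod_morphism g.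
Proof.
case: (cdualP g) => gl _ u v.
by rewrite addrC -scaleN1r -[-1 in LHS](polyCN 1) gl scaleN1r addrC.
Qed.

Lemma shift_cdualB : zmod_morphism (fun v => shift_var (f v)).
Proof. by move=> u v; rewrite cdualB shift_varB. Qed.

Let mulXB : zmod_morphism ( *%R ('X : {poly {poly K}})).
Proof. by move=> x y; rewrite mulrBr. Qed.

Lemma cdual_shiftD u v : cdual_shift f (u + v) = cdual_shift f u + cdual_shift f v.
Proof. exact: substD mulXB shift_cdualB u v. Qed.

Lemma cdual_shift0 : cdual_shift f 0 = 0.
Proof. exact: subst0. Qed.

Lemma cdual_shift_mon c k : cdual_shift f (lmon c k) = 'X^k * shift_var (f c).
Proof. by rewrite -iter_mulX; exact: subst_mon mulXB shift_cdualB c k. Qed.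

Lemma cdual_shift_scale s x :
  (forall c k, cdual_shift f (s *: lmon c k) = x * ('X^k * shift_var (f c))) ->
  forall u, cdual_shift f (s *: u) = x * cdual_shift f u.
Proof.
move=> h u; rewrite [u]lmonE scaler_sumr.
elim/big_rec2: _ => [|k v w _ IH]; first by rewrite cdual_shift0 mulr0.
by rewrite !cdual_shiftD IH h cdual_shift_mon mulrDr.
Qed.

Let G (b : A) := - cdual_shift f (prod a b).

Lemma G_linear c b b' : G (c%:P *: b + b') = c%:P%:P * G b + G b'.
Proof.
rewrite /G lsc_linearr // cdual_shiftD opprD mulrN; congr (- _ + _).
apply: cdual_shift_scale => d k; rewrite lscaleC cdual_shift_mon.
have [fl _] := cdualP f.
rewrite mulrCA -shift_varC -shift_varM mul_polyC; congr (_ * shift_var _).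
have f0 : f 0 = 0 by have := cdualB f 0 0; rewrite !subrr.
by rewrite -[_ *: d]addr0 fl f0 addr0.
Qed.

Lemma G_partial b : G ('X *: b) = 'X%:P * G b.
Proof.
rewrite /G lsc_partialr // scalerDl cdual_shiftD mulrN; congr (- _).
rewrite (@cdual_shift_scale 'X%:P ('X%:P - 'X)) => [|c k]; last first.
  rewrite lscaleC cdual_shift_mon mulrCA -shift_varX -shift_varM.
  by case: (cdualP f) => _ ->.
rewrite (@cdual_shift_scale 'X 'X) => [|c k]; last first.
  by rewrite lscaleX cdual_shift_mon exprS mulrA.
by rewrite -mulrDl subrK.
Qed.

Lemma G_D b b' : G (b + b') = G b + G b'.
Proof. by rewrite -[b in LHS]scale1r -[1](@polyC1 K) G_linear mul1r. Qed.

Lemma G_0 : G 0 = 0.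
Proof. by apply: (addrI (G 0)); rewrite -G_D !addr0. Qed.

Lemma G_scale q b : G (q *: b) = q%:P * G b.
Proof.
elim/poly_ind: q => [|q c IH]; first by rewrite scale0r mul0r G_0.
rewrite scalerDl addrC G_linear addrC polyCD mulrDl; congr (_ + _).
by rewrite mulrC -scalerA G_partial IH polyCM mulrA.
Qed.

Lemma G_coef_subproof k : conformal_linear (fun b => (G b)`_k).
Proof.
split=> [c b b'|b]; first by rewrite G_linear coefD coefCM mul_polyC.
by rewrite G_partial coefCM.
Qed.

Lemma size_G b : (size (G b) <= \max_i size (G (e i)))%N.
Proof.
have [c ->] := e_span b; pose N := (\max_i size (G (e i)))%N.
apply: (big_ind (fun v => size (G v) <= N)%N) => [|u v hu hv|i _].
- by rewrite G_0 size_poly0.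
- by rewrite G_D (leq_trans (size_polyD _ _)) // geq_max hu.
rewrite G_scale mul_polyC (leq_trans (size_scale_leq _ _)) //.
exact: (leq_bigmax i).
Qed.

Lemma dual_regularE b :
  cdual_apply (dual_regular a f) b = - cdual_shift f (prod a b).
Proof.
rewrite /dual_regular; set P := (X in xget _ X).
suff : exists F, P F by move=> /(xgetPex 0)/(_ b).
pose N := (\max_i size (G (e i)))%N.
exists (\sum_(k < N) lmon (Cdual (G_coef_subproof k)) k) => {}b.
apply/polyP => k; rewrite coef_cdual_apply lcoef_sum cdual_sum.
under eq_bigr => i _ do rewrite lcoef_mon.
case: (ltnP k N) => [lt_kN|le_Nk].
  rewrite (bigD1 (Ordinal lt_kN)) //= eqxx mulr1n big1 ?addr0 // => i.
  by rewrite -val_eqE /= => /negbTE ->.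
rewrite big1 ?[RHS]nth_default ?(leq_trans (size_G b)) // => i _.
by rewrite (_ : (i == k :> nat) = false) //; apply: ltn_eqF; apply: leq_trans le_Nk.
Qed.

End Existence.
End Dual.

Section ConformalYangBaxter.
Variables (K : fieldType) (L : lmodType {poly K}) (br : L -> L -> lpoly L).

Local Notation tensor2 := (tensor (kspace L) (kspace L)).
Local Notation tensor3 := (tensor tensor2 (kspace L)).

Definition tens2 (x y : L) : tensor2 := tpure (x : kspace L) (y : kspace L).
Definition tens3 (x y z : L) : tensor3 := tpure (tens2 x y) (z : kspace L).

Definition partial1 : tensor3 -> tensor3 := tmap (tmap (@kpartial K L) id) id.
Definition partial2 : tensor3 -> tensor3 := tmap (tmap id (@kpartial K L)) id.
Definition partial3 : tensor3 -> tensor3 := tmap (tmap id id) (@kpartial K L).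

Let id_linear (V : lmodType K) : linear (@id V). Proof. by []. Qed.
Let kpL := @kpartial_linear K L.

Lemma partial1E x y z : partial1 (tens3 x y z) = tens3 ('X *: x) y z.
Proof.
by rewrite /partial1 /tens3 tmapE ?tmapE //; apply: tmap_linear.
Qed.

Lemma partial2E x y z : partial2 (tens3 x y z) = tens3 x ('X *: y) z.
Proof.
by rewrite /partial2 /tens3 tmapE ?tmapE //; apply: tmap_linear.
Qed.

Lemma partial3E x y z : partial3 (tens3 x y z) = tens3 x y ('X *: z).
Proof.
by rewrite /partial3 /tens3 tmapE ?tmapE //; apply: tmap_linear.
Qed.

Definition ccybe_lhs m (x y : 'I_m -> L) : tensor3 :=
  \sum_i \sum_j
    (subst partial2 (fun z => tens3 z (y i) (y j)) (br (x i) (x j))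
     - subst partial3 (fun z => tens3 (x i) z (y j)) (br (x j) (y i))
     - subst partial2 (fun z => tens3 (x i) (x j) z) (br (y j) (y i))).

(* For a bilinear bracket the equation does not depend on the expression of r;
   we require it for every such expression of r. *)
Definition ccybe (r : tensor2) : Prop :=
  forall m (x y : 'I_m -> L), r = \sum_i tens2 (x i) (y i) ->
  exists t : tensor3, ccybe_lhs x y = partial1 t + partial2 t + partial3 t.

End ConformalYangBaxter.

(* Main.v *)
Require Import Defs.
From HB Require Import structures.
From mathcomp Require Import all_boot all_algebra reals.
From mathcomp Require Import ring_quotient.
From mathcomp Require Import finmap boolp monalg.
From mathcomp Require Import complex.

Set Implicit Arguments.
Unset Strict Implicit.
Unset Printing Implicit Defensive.
Import GRing.Theory.

Local Open Scope ring_scope.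
Local Open Scope complex_scope.

(** Let d1, d2, d3 denote d acting on the three tensor factors. Modulo
    d1 + d2 + d3, the substitution - lambda - d in one factor, followed by
    lambda := d2 (say), amounts to putting the operator of the third factor for
    lambda. So each bracket of the semidirect product expands into terms
    a_lambda b and L_A^*(a)_lambda f in which lambda is replaced by the
    operator of one of the other two factors ([bracketAA], [bracketAV],
    [bracketVA], [bracketVV]).

    The terms then cancel in pairs because the canonical element
    sum_j e_j (x) e_j^* is invariant: if A and its dual occupy two factors and
    lambda stands for the operator of the third one, then
      sum_j a_lambda e_j (x) e_j^* + sum_k e_k (x) L_A^*(a)_lambda e_k^* = 0
    ([canonical_invariant]). Indeed, if p_jk(lambda, d) are the coordinates of
    a_lambda e_j, the definition of L_A^* gives - p_jk(lambda, - lambda - d) as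
    the coordinates of L_A^*(a)_lambda e_k^*, and - lambda - d acting on the
    factor of the dual is d acting on the factor of A. There are six ways to
    place A and its dual in the three factors, and the six instances of this
    identity exhaust the expansion of the Yang-Baxter expression
    ([cybe_value_canonical]).

    The equation is required for every expression of r as a sum of pure
    tensors; the Yang-Baxter expression is a bilinear function of the pair
    (r, r) ([ccybe_lhsE]), so one expression is enough. *)

(** * Additive maps and polynomials with module coefficients *)

Lemma zmod_morphism0 (M N : zmodType) (f : M -> N) : zmod_morphism f -> f 0 = 0.
Proof. by move=> fB; have := fB 0 0; rewrite !subrr. Qed.

Lemma zmod_morphismN (M N : zmodType) (f : M -> N) :
  zmod_morphism f -> {morph f : x / - x}.
Proof. by move=> fB x; rewrite -sub0r fB zmod_morphism0 // sub0r. Qed.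

Lemma zmod_morphismD (M N : zmodType) (f : M -> N) :
  zmod_morphism f -> {morph f : x y / x + y}.
Proof. by move=> fB x y; apply/eqP; rewrite -subr_eq -fB addrK. Qed.

Lemma zmod_morphism_sum (M N : zmodType) (f : M -> N) I (r : seq I) (F : I -> M) :
  zmod_morphism f -> f (\sum_(i <- r) F i) = \sum_(i <- r) f (F i).
Proof.
move=> fB; elim/big_rec2: _ => [|i x y _ <-]; first exact: zmod_morphism0.
exact: zmod_morphismD.
Qed.

Lemma morphD_zmod (M N : zmodType) (f : M -> N) :
  {morph f : x y / x + y} -> zmod_morphism f.
Proof. by move=> fD x y; apply/eqP; rewrite eq_sym subr_eq -fD subrK. Qed.

Lemma lpoly_ind (M : zmodType) (P : lpoly M -> Prop) :
  P 0 -> (forall f g, P f -> P g -> P (f + g)) -> (forall c n, P (lmon c n)) ->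
  forall f, P f.
Proof. by move=> P0 PD Pm f; rewrite [f]lmonE; apply: big_ind. Qed.

(** * Substituting an operator for the spectral parameter *)

Lemma subst_morph (M N : zmodType) (D : N -> N) (phi : M -> N) :
  zmod_morphism D -> zmod_morphism phi -> zmod_morphism (subst D phi).
Proof. by move=> DB phiB f g; exact: substB. Qed.

(** The general form of the scalar rules for substitution: the scalar s, seen
    as a constant in lambda, is carried to the operator Ds that it becomes
    under phi. It is used for s = d and for s in the base field. *)
Section SubstScalar.
Variables (K : fieldType) (M : lmodType {poly K}) (N : zmodType).
Variables (D Ds : N -> N) (phi : M -> N) (s : {poly K}).
Hypotheses (DB : zmod_morphism D) (DsB : zmod_morphism Ds).
Hypotheses (phiB : zmod_morphism phi).
Hypothesis phis : forall m, phi (s *: m) = Ds (phi m).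
Hypothesis DDs : forall t, D (Ds t) = Ds (D t).

Lemma substC (f : lpoly M) : subst D phi (s%:P *: f) = Ds (subst D phi f).
Proof.
elim/lpoly_ind: f => [|f g hf hg|c n].
- by rewrite scaler0 !subst0 zmod_morphism0.
- by rewrite scalerDr !substD // hf hg zmod_morphismD.
- rewrite lscaleC !subst_mon // phis.
  by elim: n => //= n ->.
Qed.

End SubstScalar.

Section SubstScale.
Variables (K : fieldType) (M : lmodType {poly K}) (N : zmodType).
Variables (D DM : N -> N) (phi : M -> N).
Hypotheses (DB : zmod_morphism D) (DMB : zmod_morphism DM).
Hypotheses (phiB : zmod_morphism phi).
Hypothesis phiX : forall m, phi ('X *: m) = DM (phi m).
Hypothesis DDM : forall t, D (DM t) = DM (D t).
Implicit Types f g : lpoly M.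

Lemma substX f : subst D phi ('X *: f) = D (subst D phi f).
Proof.
elim/lpoly_ind: f => [|f g hf hg|c n].
- by rewrite scaler0 !subst0 zmod_morphism0.
- by rewrite scalerDr !substD // hf hg zmod_morphismD.
- by rewrite lscaleX !subst_mon.
Qed.

Lemma substXn n f : subst D phi ('X^n *: f) = iter n D (subst D phi f).
Proof.
elim: n => [|n IH]; first by rewrite expr0 scale1r.
by rewrite exprS -scalerA substX IH.
Qed.

Lemma substXC f : subst D phi ('X%:P *: f) = DM (subst D phi f).
Proof. exact: substC. Qed.

Lemma subst_opp_addX f :
  subst D phi ((- 'X - 'X%:P) *: f) = - D (subst D phi f) - DM (subst D phi f).
Proof.
have sB := subst_morph DB phiB.
by rewrite scalerBl scaleNr sB (zmod_morphismN sB) substX substXC.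
Qed.

End SubstScale.

Lemma eq_subst (M N : zmodType) (D D' : N -> N) (phi phi' : M -> N) f :
  D =1 D' -> phi =1 phi' -> subst D phi f = subst D' phi' f.
Proof. by move=> hD hp; apply: eq_bigr => k _; rewrite hp; apply: eq_iter. Qed.

Section Flip.
Variables (K : fieldType) (M : lmodType {poly K}).
Implicit Types (f : lpoly M).

Lemma lconstB : zmod_morphism (@lconst M).
Proof.
move=> x y; apply: lpolyP => n.
by rewrite lcoefD lcoefN !lcoef_mon mulrnBl.
Qed.

Lemma scale_morph (S : nzRingType) (V : lmodType S) (s : S) :
  zmod_morphism ( *:%R s : V -> V).
Proof. by move=> x y; exact: scalerBr. Qed.

Lemma lambda_flip_morph : zmod_morphism (@lambda_flip K M).
Proof. by apply: substB; [exact: scale_morph | exact: lconstB]. Qed.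

Variables (N : zmodType) (D DM D' : N -> N) (phi : M -> N).
Hypotheses (DB : zmod_morphism D) (DMB : zmod_morphism DM).
Hypotheses (phiB : zmod_morphism phi).
Hypothesis phiX : forall m, phi ('X *: m) = DM (phi m).
Hypothesis DDM : forall t, D (DM t) = DM (D t).
Hypothesis D'E : forall t, D' t = - D t - DM t.

(** Under phi, d becomes DM, so - lambda - d with D for lambda becomes - D - DM.
    When D and DM are two of the operators d1, d2, d3 and d1 + d2 + d3 = 0, this
    is the third one. *)
Lemma subst_flip f : subst D phi (lambda_flip f) = subst D' phi f.
Proof.
have D'B : zmod_morphism D'.
  move=> x y; rewrite !D'E -!opprD DB DMB addrACA.
  by rewrite -(opprD (D y)) (opprD (D x + DM x)).
have sB := subst_morph DB phiB; have s'B := subst_morph D'B phiB.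
elim/lpoly_ind: f => [|f g hf hg|c n].
- by rewrite zmod_morphism0 ?subst0 //; exact: lambda_flip_morph.
- rewrite zmod_morphismD; last exact: lambda_flip_morph.
  by rewrite !zmod_morphismD // hf hg.
- rewrite /lambda_flip !subst_mon //; last first.
  + exact: lconstB.
  + exact: scale_morph.
  elim: n => [|n IH] /=; first by rewrite subst_mon.
  by rewrite (subst_opp_addX DB DMB) // IH D'E.
Qed.

End Flip.

(** * The canonical element of a module and its conformal dual *)

Section Twist.
Variable K : fieldType.

(** p(d) becomes p(- lambda - d), an element of K[d][lambda]. *)
Definition twist (p : {poly K}) : {poly {poly K}} :=
  (map_poly (polyC \o polyC) p).[- 'X - 'X%:P].

Lemma twistD p q : twist (p + q) = twist p + twist q.
Proof. by rewrite /twist rmorphD hornerD. Qed.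

Lemma twistMX p : twist (p * 'X) = (- 'X - 'X%:P) * twist p.
Proof. by rewrite /twist rmorphM /= map_polyX hornerMX mulrC. Qed.

Lemma twistC c : twist c%:P = c%:P%:P.
Proof. by rewrite /twist map_polyC hornerC. Qed.

Variables (M V : lmodType {poly K}) (N : zmodType).
Variables (D DM DV : N -> N) (Psi : M -> V -> N).
Hypotheses (DB : zmod_morphism D) (DVB : zmod_morphism DV).
Hypotheses (PsiBl : forall f, zmod_morphism (Psi^~ f)).
Hypotheses (PsiBr : forall a, zmod_morphism (Psi a)).
Hypothesis PsiC : forall c a f, Psi (c%:P *: a) f = Psi a (c%:P *: f).
Hypothesis PsiXl : forall a f, Psi ('X *: a) f = DM (Psi a f).
Hypothesis PsiXr : forall a f, Psi a ('X *: f) = DV (Psi a f).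
Hypothesis DDV : forall t, D (DV t) = DV (D t).
Hypothesis total0 : forall t, - D t - DV t = DM t.

(** Since DM + DV + D = 0, the operator - lambda - d on the second argument of
    Psi, with D for lambda, is d on the first argument: polynomials in d move
    from one argument to the other. *)
Lemma subst_twist p a f :
  subst D (Psi a) (twist p *: lconst f) = Psi (p *: a) f.
Proof.
have sB := subst_morph DB (PsiBr a).
elim/poly_ind: p => [|p c IH].
  rewrite scale0r (zmod_morphism0 (PsiBl f)) -[0](@polyC0 K) twistC !polyC0.
  by rewrite scale0r zmod_morphism0.
have -> : (p * 'X + c%:P) *: a = 'X *: (p *: a) + c%:P *: a.
  by rewrite scalerDl mulrC scalerA.
rewrite (zmod_morphismD (PsiBl f)) PsiXl -IH PsiC -total0.
rewrite -(subst_opp_addX DB DVB) // -[X in _ = _ + X](subst_mon DB (PsiBr a) _ 0).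
by rewrite -zmod_morphismD // -lscaleC scalerA -scalerDl twistD twistMX twistC.
Qed.

End Twist.

Section Dual.
Variables (K : fieldType) (A : lmodType {poly K}).
Implicit Types (a b : A) (f g : cdual A) (p : {poly K}).

Lemma cdual_scaleE f p a : f (p *: a) = p * f a.
Proof.
have fB := cdualB f; case: (cdualP f) => fl fX.
elim/poly_ind: p => [|p c IH]; first by rewrite scale0r mul0r zmod_morphism0.
by rewrite scalerDl addrC fl mulrC -scalerA fX IH mulrDl addrC mulrA mul_polyC.
Qed.

Lemma cdual_applyB b : zmod_morphism ((@cdual_apply K A)^~ b).
Proof.
apply: substB => [x y|f g]; first exact: mulrBr.
by rewrite /= polyCD polyCN.
Qed.

(** The pairing (q, g) |-> q(mu - lambda) g_mu(b) of K[d] with the dual satisfies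
    the relation required by [subst_twist]: lambda, the factor - mu by which d
    acts on g, and the factor mu - lambda by which d acts on q add up to 0. *)
Lemma cdual_apply_twist n p f b :
  cdual_apply ('X^n *: (twist p *: lconst f)) b = 'X^n * (shift_var p * (f b)%:P).
Proof.
pose Psi (q : {poly K}^o) (g : cdual A) := shift_var q * (g b)%:P.
have DB (s : {poly {poly K}}) : zmod_morphism ( *%R s) by move=> x y; rewrite mulrBr.
have PsiBr q : zmod_morphism (Psi q).
  by move=> g h; rewrite /Psi /= polyCD polyCN mulrDr mulrN.
have PsiBl g : zmod_morphism (Psi^~ g).
  by move=> x y; rewrite /Psi shift_varB mulrBl.
have E := @subst_twist K {poly K}^o _ _
  ( *%R 'X) ( *%R ('X%:P - 'X)) ( *%R (- 'X%:P)) Psi.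
have {}E : subst ( *%R 'X) (Psi 1) (twist p *: lconst f) = Psi (p *: 1) f.
  apply: E => //.
  - move=> c q g; rewrite /Psi -[c%:P *: q]/(c%:P * q) shift_varM shift_varC.
    by rewrite /= comp_polyC polyCM mulrCA mulrA.
  - move=> q g; rewrite /Psi -[_ *: q]/('X * q) shift_varM shift_varX.
    by rewrite mulrA.
  - move=> q g; rewrite /Psi cdual_partialE polyCM polyCN !mulrA.
    by rewrite [_ * shift_var q]mulrC.
  - by move=> t; rewrite mulrCA.
  - by move=> t; rewrite mulNr opprK mulrBl addrC.
have -> : cdual_apply ('X^n *: (twist p *: lconst f)) b
   = subst ( *%R 'X) (Psi 1) ('X^n *: (twist p *: lconst f)).
  by apply: eq_subst => // g; rewrite /Psi -[1](@polyC1 K) shift_varC mul1r.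
by rewrite substXn // E iter_mulX /Psi [_ *: _]mulr1.
Qed.

Variables (n : nat) (e : 'I_n -> A) (es : 'I_n -> cdual A).
Hypotheses (e_basis : module_basis e) (es_dual : dual_family e es).

Lemma basis_expand a : a = \sum_i es i a *: e i.
Proof.
have [c ac] := e_basis.1 a; rewrite {1}ac; apply: eq_bigr => i _.
congr (_ *: _); rewrite ac (zmod_morphism_sum _ _ (cdualB _)) (bigD1 i) //=.
rewrite cdual_scaleE es_dual eqxx mulr1 big1 ?addr0 // => j ji.
by rewrite cdual_scaleE es_dual eq_sym (negbTE ji) mulr0.
Qed.

Variables (prod : A -> A -> lpoly A) (Aprod : left_symmetric_conformal prod).

(** Transposition: the coordinates of L_A^*(a)_lambda e_k^* are those of the
    a_lambda e_j on e_k, up to sign and with - lambda - d for d. *)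
Lemma dual_regular_dual a k :
  dual_regular prod a (es k)
  = - \sum_j \sum_(m <- lsupp (prod a (e j)))
        'X^m *: (twist (es k (lcoef (prod a (e j)) m)) *: lconst (es j)).
Proof.
apply: cdual_apply_inj => b; rewrite (dual_regularE Aprod e_basis.1).
have bB := cdual_applyB b.
rewrite (zmod_morphismN bB) (zmod_morphism_sum _ _ bB).
rewrite [b in LHS]basis_expand.
pose G x := - cdual_shift (es k) (prod a x).
rewrite -[LHS]/(G _) (@zmod_morphism_sum _ _ G); last first.
  by apply: morphD_zmod => x y; exact: G_D.
rewrite -sumrN; apply: eq_bigr => j _.
rewrite /G G_scale // mulrN; congr (- _).
rewrite (zmod_morphism_sum _ _ bB) /cdual_shift /subst mulr_sumr.
apply: eq_bigr => m _.
by rewrite cdual_apply_twist iter_mulX mulrCA [_%:P * _]mulrC.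
Qed.

Variables (N : zmodType) (D DM DV : N -> N) (Psi : A -> cdual A -> N).
Hypotheses (DB : zmod_morphism D) (DVB : zmod_morphism DV).
Hypotheses (PsiBl : forall f, zmod_morphism (Psi^~ f)).
Hypotheses (PsiBr : forall a, zmod_morphism (Psi a)).
Hypothesis PsiC : forall c a f, Psi (c%:P *: a) f = Psi a (c%:P *: f).
Hypothesis PsiXl : forall a f, Psi ('X *: a) f = DM (Psi a f).
Hypothesis PsiXr : forall a f, Psi a ('X *: f) = DV (Psi a f).
Hypothesis DDV : forall t, D (DV t) = DV (D t).
Hypothesis total0 : forall t, - D t - DV t = DM t.

(** Invariance of the canonical element. By [dual_regular_dual] both sides are
    sums over the same coordinates of the a_lambda e_j, which [subst_twist]
    moves from the dual basis to the basis. *)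
Lemma canonical_invariant a :
  \sum_j subst D (Psi^~ (es j)) (prod a (e j))
  = - \sum_k subst D (Psi (e k)) (dual_regular prod a (es k)).
Proof.
have sB k := subst_morph DB (PsiBr (e k)).
have iB m : zmod_morphism (iter m D).
  by elim: m => [|m IH] x y //=; rewrite IH DB.
transitivity (\sum_k \sum_j \sum_(m <- lsupp (prod a (e j)))
   iter m D (Psi (es k (lcoef (prod a (e j)) m) *: e k) (es j))); last first.
  rewrite -sumrN; apply: eq_bigr => k _; rewrite dual_regular_dual.
  rewrite (zmod_morphismN (sB k)) opprK (zmod_morphism_sum _ _ (sB k)).
  apply: eq_bigr => j _; rewrite (zmod_morphism_sum _ _ (sB k)).
  apply: eq_bigr => m _; rewrite substXn //; congr (iter _ _ _).
  exact/esym/(subst_twist DB DVB).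
rewrite exchange_big /=; apply: eq_bigr => j _.
rewrite exchange_big /=; apply: eq_bigr => m _.
rewrite [X in Psi X]basis_expand (zmod_morphism_sum _ _ (PsiBl _)).
exact: zmod_morphism_sum.
Qed.

End Dual.

(** * Bilinearity of the semidirect bracket *)

(** K-bilinearity: the base field K sits in K[d] and in K[d][lambda] as the
    constants. *)
Definition lambda_bilinear (K : fieldType) (U V W : lmodType {poly K})
    (br : U -> V -> lpoly W) : Prop :=
  (forall c x x' y, br (c%:P *: x + x') y = c%:P%:P *: br x y + br x' y)
  /\ (forall c x y y', br x (c%:P *: y + y') = c%:P%:P *: br x y + br x y').

Section LambdaBilinear.
Variables (K : fieldType) (U V W : lmodType {poly K}) (br : U -> V -> lpoly W).
Hypothesis brP : lambda_bilinear br.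

Lemma lbilin0l y : br 0 y = 0.
Proof.
by have := brP.1 (-1) 0 0 y; rewrite scaler0 addr0 !polyCN !polyC1 scaleN1r addNr.
Qed.

Lemma lbilin0r x : br x 0 = 0.
Proof.
by have := brP.2 (-1) x 0 0; rewrite scaler0 addr0 !polyCN !polyC1 scaleN1r addNr.
Qed.

End LambdaBilinear.

Section LpolyMap.
Variables (M N : zmodType) (phi : M -> N).
Hypothesis phiB : zmod_morphism phi.

Lemma lcoef_lpoly_map f n : lcoef (lpoly_map phi f) n = phi (lcoef f n).
Proof.
rewrite {2}[f]lmonE !lcoef_sum (zmod_morphism_sum _ _ phiB).
apply: eq_bigr => k _; rewrite !lcoef_mon.
by case: eqP => // _; rewrite mulr0n zmod_morphism0.
Qed.

Lemma lpoly_map_morph : zmod_morphism (lpoly_map phi).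
Proof.
move=> f g; apply: lpolyP => n.
by rewrite lcoefD lcoefN !lcoef_lpoly_map lcoefD lcoefN phiB.
Qed.

Lemma lpoly_map_mon c n : lpoly_map phi (lmon c n) = lmon (phi c) n.
Proof.
apply: lpolyP => m; rewrite lcoef_lpoly_map !lcoef_mon.
by case: eqP => // _; rewrite mulr0n zmod_morphism0.
Qed.

Lemma subst_lpoly_map (P : zmodType) (D : P -> P) (psi : N -> P) f :
  zmod_morphism D -> zmod_morphism psi ->
  subst D psi (lpoly_map phi f) = subst D (psi \o phi) f.
Proof.
move=> DB psiB; rewrite /lpoly_map (zmod_morphism_sum _ _ (subst_morph DB psiB)).
by apply: eq_bigr => k _; rewrite subst_mon.
Qed.

End LpolyMap.

Lemma lpoly_mapC (K : fieldType) (M N : lmodType {poly K}) (phi : M -> N) c f :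
  zmod_morphism phi -> (forall m, phi (c *: m) = c *: phi m) ->
  lpoly_map phi (c%:P *: f) = c%:P *: lpoly_map phi f.
Proof.
move=> phiB phic; elim/lpoly_ind: f => [|f g hf hg|m n].
- by rewrite scaler0 zmod_morphism0 ?scaler0 //; exact: lpoly_map_morph.
- rewrite scalerDr !(zmod_morphismD (lpoly_map_morph phiB)) hf hg.
  by rewrite scalerDr.
- by rewrite lscaleC !lpoly_map_mon // lscaleC phic.
Qed.

Lemma lambda_flipC (K : fieldType) (M : lmodType {poly K}) c (f : lpoly M) :
  lambda_flip (c%:P *: f) = c%:P *: lambda_flip f.
Proof.
apply: substC => [|||m|t]; try exact: scale_morph.
- exact: lconstB.
- by rewrite /lconst lscaleC.
- by rewrite !scalerA mulrC.
Qed.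

Lemma addr_scaleACA (S : nzRingType) (W : lmodType S) (s : S) (a a' b b' : W) :
  (s *: a + a') + (s *: b + b') = s *: (a + b) + (a' + b').
Proof. by rewrite scalerDr addrACA. Qed.

Section SemidirectBilinear.
Variables (K : fieldType) (A V : lmodType {poly K}).
Variables (br : A -> A -> lpoly A) (rho : A -> V -> lpoly V).
Hypotheses (brP : lambda_bilinear br) (rhoP : lambda_bilinear rho).

Let inl_morph : zmod_morphism (fun a : A => (a, 0) : A * V).
Proof. by move=> a b; congr pair; rewrite subr0. Qed.
Let inr_morph : zmod_morphism (fun f : V => (0, f) : A * V).
Proof. by move=> a b; congr pair; rewrite subr0. Qed.
Let inlC (c : {poly K}) a : (c *: a, 0) = c *: (a, 0) :> (A * V).
Proof. by congr pair; rewrite scaler0. Qed.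
Let inrC (c : {poly K}) f : (0, c *: f) = c *: (0, f) :> (A * V).
Proof. by congr pair; rewrite scaler0. Qed.

Lemma semidirect_bilinear : lambda_bilinear (semidirect br rho).
Proof.
have lB := lpoly_map_morph inl_morph; have rB := lpoly_map_morph inr_morph.
have fD := zmod_morphismD (@lambda_flip_morph K V).
have lC c u := @lpoly_mapC K A _ _ c u inl_morph (inlC c).
have rC c u := @lpoly_mapC K V _ _ c u inr_morph (inrC c).
split=> c x x' y; rewrite /semidirect /= ?brP.1 ?brP.2 ?rhoP.1 ?rhoP.2.
- rewrite fD lambda_flipC opprD addrACA -scalerBr.
  rewrite (zmod_morphismD lB) (zmod_morphismD rB) lC rC.
  exact: addr_scaleACA.
- rewrite fD lambda_flipC opprD addrACA -scalerBr.
  rewrite (zmod_morphismD lB) (zmod_morphismD rB) lC rC.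
  exact: addr_scaleACA.
Qed.

Variables (N : zmodType) (D : N -> N) (phi : A * V -> N).
Hypotheses (DB : zmod_morphism D) (phiB : zmod_morphism phi).

Lemma subst_semidirect x y :
  subst D phi (semidirect br rho x y)
  = subst D (fun a => phi (a, 0)) (br x.1 y.1)
    + (subst D (fun f => phi (0, f)) (rho x.1 y.2)
       - subst D (fun f => phi (0, f)) (lambda_flip (rho y.1 x.2))).
Proof.
have sB := subst_morph DB phiB.
have rB : zmod_morphism (subst D (fun f : V => phi (0, f))).
  by apply: substB => // f g; rewrite inr_morph phiB.
by rewrite (zmod_morphismD sB) !subst_lpoly_map // rB.
Qed.

End SemidirectBilinear.

Lemma subadjacent_bilinear (K : fieldType) (A : lmodType {poly K})
    (prod : A -> A -> lpoly A) :
  lambda_bilinear prod -> lambda_bilinear (subadjacent prod).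
Proof.
move=> prodP; have fD := zmod_morphismD (@lambda_flip_morph K A).
split=> c x x' y; rewrite /subadjacent prodP.1 prodP.2 fD lambda_flipC opprD.
  by rewrite addrACA scalerBr.
by rewrite addrACA scalerBr.
Qed.

Section DualBilinear.
Variables (K : fieldType) (A : lmodType {poly K}).
Variables (prod : A -> A -> lpoly A) (Aprod : left_symmetric_conformal prod).

Lemma lsc_bilinear : lambda_bilinear prod.
Proof. by split=> *; [exact: lsc_linearl | exact: lsc_linearr]. Qed.

Variables (n : nat) (e : 'I_n -> A).
Hypothesis e_span :
  forall a, exists c : 'I_n -> {poly K}, a = \sum_i c i *: e i.

Lemma cdual_applyC c (F : lpoly (cdual A)) b :
  cdual_apply (c%:P%:P *: F) b = c%:P%:P * cdual_apply F b.
Proof.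
apply: (@substC _ _ _ ( *%R 'X) ( *%R c%:P%:P)) => [x y|x y|f g|f|t].
- by rewrite mulrBr.
- by rewrite mulrBr.
- by rewrite /= polyCD polyCN.
- by rewrite /= comp_polyC polyCM.
- by rewrite mulrCA.
Qed.

Lemma cdual_shiftC c (f : cdual A) u :
  cdual_shift f (c%:P%:P *: u) = c%:P%:P * cdual_shift f u.
Proof.
apply: (@substC _ _ _ ( *%R 'X) ( *%R c%:P%:P)) => [x y|x y|||t].
- by rewrite mulrBr.
- by rewrite mulrBr.
- exact: shift_cdualB.
- by move=> m; rewrite cdual_scaleE shift_varM shift_varC.
- by rewrite mulrCA.
Qed.

Lemma cdual_shift_linearl c (f g : cdual A) u :
  cdual_shift (c%:P *: f + g) u = c%:P%:P * cdual_shift f u + cdual_shift g u.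
Proof.
rewrite /cdual_shift /subst mulr_sumr -big_split; apply: eq_bigr => k _ /=.
rewrite !iter_mulX comp_polyC (zmod_morphismD (@shift_varB K)) shift_varM.
by rewrite shift_varC mulrDr mulrCA.
Qed.

(** An element of the dual with polynomial coefficients is determined by its
    values, and those of L_A^*(a)_lambda f are bilinear in a and f. *)
Lemma dual_regular_bilinear : lambda_bilinear (dual_regular prod).
Proof.
split=> c x x' y; apply: cdual_apply_inj => b;
  rewrite (zmod_morphismD (@cdual_applyB _ _ b)) cdual_applyC;
  rewrite !(dual_regularE Aprod e_span) mulrN -opprD; congr (- _).
- by rewrite (lsc_linearl Aprod) cdual_shiftD cdual_shiftC.
- exact: cdual_shift_linearl.
Qed.

End DualBilinear.

(** * The Yang-Baxter expression as a quadratic function of the tensor *)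

Section TensorLift.
Variables (K : fieldType) (U V W : lmodType K).

Lemma tlift_lincomb c (h h' h'' : U -> V -> W) t :
  (forall u v, h'' u v = c *: h u v + h' u v) ->
  tlift h'' t = c *: tlift h t + tlift h' t.
Proof.
move=> hE; rewrite /tlift /free_lift scaler_sumr -big_split /=.
by apply: eq_bigr => k _; rewrite hE scalerDr !scalerA mulrC.
Qed.

End TensorLift.

Section SubstLinear.
Variables (K : fieldType) (L : lmodType {poly K}) (T : lmodType K).
Variable D : T -> T.
Hypothesis Dl : linear D.

Lemma subst_lin_arg (phi : kspace L -> T) c (f g : lpoly L) : linear phi ->
  subst D (phi : L -> T) (c%:P%:P *: f + g)
  = c *: subst D (phi : L -> T) f + subst D (phi : L -> T) g.
Proof.
move=> phil; have DB := zmod_morphism_linear Dl.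
have phiB : zmod_morphism (phi : L -> T) := zmod_morphism_linear phil.
rewrite (zmod_morphismD (subst_morph DB phiB)); congr (_ + _).
apply: (@substC _ _ _ D ( *:%R c)) => //; first exact: scale_morph.
  by move=> m; exact: (scalable_linear phil c m).
by move=> t; rewrite (scalable_linear Dl).
Qed.

Lemma subst_lin_fun (phi phi' phi'' : L -> T) c f :
  (forall z, phi'' z = c *: phi z + phi' z) ->
  subst D phi'' f = c *: subst D phi f + subst D phi' f.
Proof.
move=> phiE; rewrite /subst scaler_sumr -big_split; apply: eq_bigr => k _ /=.
rewrite phiE (iterDD (zmod_morphism_linear Dl)); congr (_ + _).
by move: (phi (lcoef f k)) => t; elim: k => //= k ->; exact: scalable_linear.
Qed.

End SubstLinear.

Lemma lincombBB (K : nzRingType) (W : lmodType K) c (a a' b b' d d' : W) :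
  (c *: a + a') - (c *: b + b') - (c *: d + d')
  = c *: (a - b - d) + (a' - b' - d').
Proof. by rewrite !scalerBr !opprD (addrACA (c *: a)) (addrACA (c *: a - c *: b)).
Qed.

Section QuadraticForm.
Variables (K : fieldType) (L : lmodType {poly K}) (br : L -> L -> lpoly L).
Hypothesis brP : lambda_bilinear br.

Local Notation kL := (kspace L).
Local Notation tensor2 := (tensor kL kL).
Local Notation tensor3 := (tensor tensor2 kL).

Lemma partial1_linear : linear (@partial1 K L).
Proof.
by do 2 apply: tmap_linear => //; [exact: kpartial_linear].
Qed.

Lemma partial2_linear : linear (@partial2 K L).
Proof.
by do 2 apply: tmap_linear => //; [exact: kpartial_linear].
Qed.

Lemma partial3_linear : linear (@partial3 K L).
Proof.
apply: tmap_linear; last exact: kpartial_linear.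
exact: tmap_linear.
Qed.

Lemma tens3_linear1 y z : linear (fun x : kL => tens3 x y z : tensor3).
Proof. by move=> c x x'; rewrite /tens3 /tens2 tpureDl tpureZl tpureDl tpureZl. Qed.

Lemma tens3_linear2 x z : linear (fun y : kL => tens3 x y z : tensor3).
Proof. by move=> c y y'; rewrite /tens3 /tens2 tpureDr tpureZr tpureDl tpureZl. Qed.

Lemma tens3_linear3 x y : linear (fun z : kL => tens3 x y z : tensor3).
Proof. by move=> c z z'; rewrite /tens3 tpureDr tpureZr. Qed.

Definition cybe_form (x y x' y' : kL) : tensor3 :=
  subst (@partial2 K L) (fun z => tens3 z y y') (br x x')
  - subst (@partial3 K L) (fun z => tens3 x z y') (br x' y)
  - subst (@partial2 K L) (fun z => tens3 x x' z) (br y' y).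

Let p2 := partial2_linear.
Let p3 := partial3_linear.
Let t1 := tens3_linear1.
Let t2 := tens3_linear2.
Let t3 := tens3_linear3.

Lemma cybe_form_linear1 y x' y' : linear (fun x => cybe_form x y x' y').
Proof.
move=> c u v; rewrite /cybe_form -lincombBB; congr (_ - _ - _).
- by rewrite brP.1 (subst_lin_arg p2 _ _ _ (t1 _ _)).
- by apply: (subst_lin_fun p3) => z; exact: t1.
- by apply: (subst_lin_fun p2) => z; exact: t1.
Qed.

Lemma cybe_form_linear2 x x' y' : linear (fun y => cybe_form x y x' y').
Proof.
move=> c u v; rewrite /cybe_form -lincombBB; congr (_ - _ - _).
- by apply: (subst_lin_fun p2) => z; exact: t2.
- by rewrite brP.2 (subst_lin_arg p3 _ _ _ (t2 _ _)).
- by rewrite brP.2 (subst_lin_arg p2 _ _ _ (t3 _ _)).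
Qed.

Lemma cybe_form_linear3 x y y' : linear (fun x' => cybe_form x y x' y').
Proof.
move=> c u v; rewrite /cybe_form -lincombBB; congr (_ - _ - _).
- by rewrite brP.2 (subst_lin_arg p2 _ _ _ (t1 _ _)).
- by rewrite brP.1 (subst_lin_arg p3 _ _ _ (t2 _ _)).
- by apply: (subst_lin_fun p2) => z; exact: t2.
Qed.

Lemma cybe_form_linear4 x y x' : linear (fun y' => cybe_form x y x' y').
Proof.
move=> c u v; rewrite /cybe_form -lincombBB; congr (_ - _ - _).
- by apply: (subst_lin_fun p2) => z; exact: t3.
- by apply: (subst_lin_fun p3) => z; exact: t3.
- by rewrite brP.1 (subst_lin_arg p2 _ _ _ (t3 _ _)).
Qed.

(** The Yang-Baxter expression of a pair of tensors, defined through the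
    universal property of the tensor product, hence independent of how the
    tensors are written. *)
Definition cybe_bilin (r r' : tensor2) : tensor3 :=
  tlift (fun x y => tlift (fun x' y' => cybe_form x y x' y') r') r.

Let bil_l y r : linear (fun x => tlift (fun x' y' => cybe_form x y x' y') r).
Proof. by move=> c u v; apply: tlift_lincomb => *; exact: cybe_form_linear1. Qed.
Let bil_r x r : linear (fun y => tlift (fun x' y' => cybe_form x y x' y') r).
Proof. by move=> c u v; apply: tlift_lincomb => *; exact: cybe_form_linear2. Qed.

Lemma cybe_bilin_linearl r' : linear (cybe_bilin^~ r').
Proof. by apply: tlift_linear => z; [exact: bil_l | exact: bil_r]. Qed.

Lemma cybe_bilin_linearr r : linear (cybe_bilin r).
Proof.
move=> c t t'; apply: tlift_lincomb => x y; apply: tlift_linear => *.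
  exact: cybe_form_linear3.
exact: cybe_form_linear4.
Qed.

Lemma cybe_bilinE x y x' y' :
  cybe_bilin (tens2 x y) (tens2 x' y') = cybe_form x y x' y'.
Proof.
rewrite /cybe_bilin /tens2 tliftE // tliftE // => *.
  exact: cybe_form_linear3.
exact: cybe_form_linear4.
Qed.

Lemma cybe_bilinBl r r1 r2 : cybe_bilin (r1 - r2) r = cybe_bilin r1 r - cybe_bilin r2 r.
Proof. exact: (zmod_morphism_linear (cybe_bilin_linearl r)). Qed.

Lemma cybe_bilinBr r r1 r2 : cybe_bilin r (r1 - r2) = cybe_bilin r r1 - cybe_bilin r r2.
Proof. exact: (zmod_morphism_linear (cybe_bilin_linearr r)). Qed.

Lemma cybe_bilin_sum I J (s : seq I) (s' : seq J)
    (F : I -> tensor2) (G : J -> tensor2) :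
  cybe_bilin (\sum_(i <- s) F i) (\sum_(j <- s') G j)
  = \sum_(i <- s) \sum_(j <- s') cybe_bilin (F i) (G j).
Proof.
rewrite (zmod_morphism_sum _ _ (zmod_morphism_linear (cybe_bilin_linearl _))).
apply: eq_bigr => i _.
exact: (zmod_morphism_sum _ _ (zmod_morphism_linear (cybe_bilin_linearr _))).
Qed.

Lemma cybe_bilin_skew n (x y : 'I_n -> L) :
  let r := \sum_i (tens2 (x i) (y i) - tens2 (y i) (x i)) in
  cybe_bilin r r
  = \sum_i \sum_j
    (cybe_form (x i) (y i) (x j) (y j) - cybe_form (x i) (y i) (y j) (x j)
     - (cybe_form (y i) (x i) (x j) (y j) - cybe_form (y i) (x i) (y j) (x j))).
Proof.
rewrite /= cybe_bilin_sum; apply: eq_bigr => i _; apply: eq_bigr => j _.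
by rewrite cybe_bilinBl !cybe_bilinBr !cybe_bilinE.
Qed.

Lemma ccybe_lhsE m (x y : 'I_m -> L) r :
  r = \sum_i tens2 (x i) (y i) -> ccybe_lhs br x y = cybe_bilin r r.
Proof.
move=> ->; rewrite cybe_bilin_sum; apply: eq_bigr => i _; apply: eq_bigr => j _.
by rewrite cybe_bilinE.
Qed.

End QuadraticForm.

(** * Trilinear forms invariant under the total derivative *)

(** The properties of the class of x (x) y (x) z modulo d1 + d2 + d3 that the
    computation uses. They are preserved by permutations of the arguments
    ([it_swap12], [it_swap23]), so a fact about one factor gives the
    corresponding facts about the two others. *)
Record invariant_trilinear (K : fieldType) (L : lmodType {poly K}) (Q : zmodType)
    (X : L -> L -> L -> Q) (D1 D2 D3 : Q -> Q) : Prop := InvariantTrilinear {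
  itD1 : zmod_morphism D1;
  itD2 : zmod_morphism D2;
  itD3 : zmod_morphism D3;
  itC12 : forall t, D1 (D2 t) = D2 (D1 t);
  itC13 : forall t, D1 (D3 t) = D3 (D1 t);
  itC23 : forall t, D2 (D3 t) = D3 (D2 t);
  it_total : forall t, D1 t + D2 t + D3 t = 0;
  it_add1 : forall y z, zmod_morphism (fun x => X x y z);
  it_add2 : forall x z, zmod_morphism (fun y => X x y z);
  it_add3 : forall x y, zmod_morphism (fun z => X x y z);
  it_scal12 : forall c x y z, X (c%:P *: x) y z = X x (c%:P *: y) z;
  it_scal23 : forall c x y z, X x (c%:P *: y) z = X x y (c%:P *: z);
  it_partial1 : forall x y z, X ('X *: x) y z = D1 (X x y z);
  it_partial2 : forall x y z, X x ('X *: y) z = D2 (X x y z);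
  it_partial3 : forall x y z, X x y ('X *: z) = D3 (X x y z)
}.

Section Permute.
Variables (K : fieldType) (L : lmodType {poly K}) (Q : zmodType).
Variables (X : L -> L -> L -> Q) (D1 D2 D3 : Q -> Q).
Hypothesis XP : invariant_trilinear X D1 D2 D3.

Lemma it_swap12 : invariant_trilinear (fun x y z => X y x z) D2 D1 D3.
Proof.
case: XP => D1B D2B D3B C12 C13 C23 tot a1 a2 a3 s12 s23 p1 p2 p3.
by split=> // *; rewrite ?[D2 _ + D1 _]addrC ?s12 ?s23.
Qed.

Lemma it_swap23 : invariant_trilinear (fun x y z => X x z y) D1 D3 D2.
Proof.
case: XP => D1B D2B D3B C12 C13 C23 tot a1 a2 a3 s12 s23 p1 p2 p3.
by split=> // *; rewrite ?[_ + _ + D2 _]addrAC ?s12 ?s23.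
Qed.

End Permute.

Section Slots.
Variables (K : fieldType) (A : lmodType {poly K}) (prod : A -> A -> lpoly A).
Hypothesis Aprod : left_symmetric_conformal prod.
Variables (n : nat) (e : 'I_n -> A) (es : 'I_n -> cdual A).
Hypotheses (e_basis : module_basis e) (es_dual : dual_family e es).
Local Notation L := (A * cdual A)%type.
Local Notation rho := (dual_regular prod).
Local Notation br := (semidirect (subadjacent prod) rho).

Definition inA (a : A) : L := (a, 0).
Definition inV (f : cdual A) : L := (0, f).

Lemma inAB : zmod_morphism inA.
Proof. by move=> a b; congr pair; rewrite subr0. Qed.
Lemma inVB : zmod_morphism inV.
Proof. by move=> a b; congr pair; rewrite subr0. Qed.
Lemma inAZ p a : inA (p *: a) = p *: inA a.
Proof. by congr pair; rewrite scaler0. Qed.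
Lemma inVZ p f : inV (p *: f) = p *: inV f.
Proof. by congr pair; rewrite scaler0. Qed.

Section OneForm.
Variables (Q : zmodType) (X : L -> L -> L -> Q) (D1 D2 D3 : Q -> Q).
Hypothesis XP : invariant_trilinear X D1 D2 D3.

Lemma it_third t : - D2 t - D1 t = D3 t.
Proof.
apply/eqP; rewrite -opprD eq_sym -addr_eq0 addrC [D2 t + _]addrC.
by rewrite (it_total XP).
Qed.

(** Invariance of the canonical element with A in the first factor and its dual
    in the second one; the five other placements are instances of it for the
    forms with permuted arguments. *)
Lemma canonical_slots12 a w :
  \sum_j subst D3 (fun u => X (inA u) (inV (es j)) w) (prod a (e j))
  = - \sum_k subst D3 (fun f => X (inA (e k)) (inV f) w) (rho a (es k)).
Proof.
apply: (@canonical_invariant _ _ _ _ _ e_basis es_dual _ Aprod _ D3 D1 D2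
         (fun u f => X (inA u) (inV f) w)); try by case: XP.
- by move=> f u v; rewrite inAB (it_add1 XP).
- by move=> u f g; rewrite inVB (it_add2 XP).
- by move=> c u f; rewrite inAZ inVZ (it_scal12 XP).
- by move=> u f; rewrite inAZ (it_partial1 XP).
- by move=> u f; rewrite inVZ (it_partial2 XP).
- move=> t; apply/eqP; rewrite -opprD eq_sym -addr_eq0.
  by rewrite [D3 t + _]addrC addrA (it_total XP).
Qed.

Lemma subst_flip_slot1 (M : lmodType {poly K}) (i : M -> L) y z u :
  zmod_morphism i -> (forall m, i ('X *: m) = 'X *: i m) ->
  subst D2 (fun m => X (i m) y z) (lambda_flip u) = subst D3 (fun m => X (i m) y z) u.
Proof.
move=> iB iX; apply: (@subst_flip _ _ _ D2 D1) => [|||m|t|t].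
- exact: itD2 XP.
- exact: itD1 XP.
- by move=> p q; rewrite iB (it_add1 XP).
- by rewrite iX (it_partial1 XP).
- by rewrite (itC12 XP).
- by rewrite it_third.
Qed.

Let rhoP := dual_regular_bilinear Aprod e_basis.1.

Let sA y z : zmod_morphism (subst D2 (fun m => X (inA m) y z)).
Proof. by apply: subst_morph (itD2 XP) _ => p q; rewrite inAB (it_add1 XP). Qed.

Let sE y z u v : subst D2 (fun x => X x y z) (br u v)
  = subst D2 (fun a => X (inA a) y z) (subadjacent prod u.1 v.1)
    + (subst D2 (fun f => X (inV f) y z) (rho u.1 v.2)
       - subst D3 (fun f => X (inV f) y z) (rho v.1 u.2)).
Proof.
rewrite (@subst_semidirect _ _ _ _ _ _ D2) //; last exact: (it_add1 XP).
- congr (_ + (_ - _)); apply: (@subst_flip_slot1 _ inV); first exact: inVB.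
  exact: inVZ.
- exact: itD2 XP.
Qed.

Let adjE y z a b : subst D2 (fun u => X (inA u) y z) (subadjacent prod a b)
  = subst D2 (fun u => X (inA u) y z) (prod a b)
    - subst D3 (fun u => X (inA u) y z) (prod b a).
Proof.
rewrite sA (@subst_flip_slot1 _ inA) //; [exact: inAB | exact: inAZ].
Qed.

(** The brackets of the semidirect product in the first factor, with d2 for
    lambda; the terms in - lambda - d carry d3 by [subst_flip_slot1]. *)
Lemma bracketAA y z a b : subst D2 (fun x => X x y z) (br (inA a) (inA b))
  = subst D2 (fun u => X (inA u) y z) (prod a b)
    - subst D3 (fun u => X (inA u) y z) (prod b a).
Proof.
by rewrite sE adjE /= !(lbilin0r rhoP) !subst0 subrr addr0.
Qed.

Let lP := subadjacent_bilinear (lsc_bilinear Aprod).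

Lemma bracketAV y z a f : subst D2 (fun x => X x y z) (br (inA a) (inV f))
  = subst D2 (fun u => X (inV u) y z) (rho a f).
Proof.
by rewrite sE /= (lbilin0r lP) (lbilin0l rhoP) !subst0 add0r subr0.
Qed.

Lemma bracketVA y z b f : subst D2 (fun x => X x y z) (br (inV f) (inA b))
  = - subst D3 (fun u => X (inV u) y z) (rho b f).
Proof.
by rewrite sE /= (lbilin0l lP) (lbilin0l rhoP) !subst0 !add0r.
Qed.

Lemma bracketVV y z f g : subst D2 (fun x => X x y z) (br (inV f) (inV g)) = 0.
Proof.
by rewrite sE /= (lbilin0l lP) !(lbilin0l rhoP) !subst0 subr0 addr0.
Qed.

End OneForm.

(** The signs come from the expansion in [cybe_value_canonical]: p_k stands for
    the sum of the family P_k there, and - p_k for that of R_k. *)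
Lemma six_pairs_cancel (Q : zmodType) (p1 p2 p3 p4 p5 p6 : Q) :
  (p1 - p2 - - p2) - (- p5 - - p1)
  - ((- - p3 - (p3 - p4) - - - p4) - (- - - p6 - (p5 - p6))) = 0.
Proof.
have -> : - - p3 - (p3 - p4) - - - p4 = 0.
  by rewrite !opprK opprB addrCA subrr addr0 subrr.
have -> : - - - p6 - (p5 - p6) = - p5 by rewrite !opprK opprB addKr.
by rewrite !opprK subrK add0r opprD opprK addrCA subrr addr0 subrr.
Qed.

Section CanonicalSolution.
Variables (Q : zmodType) (X : L -> L -> L -> Q) (D1 D2 D3 : Q -> Q).
Hypothesis XP : invariant_trilinear X D1 D2 D3.

(** The image of [cybe_form] when X is the class of the pure tensor, as in
    [cube_proj_cybe_form]. *)
Definition cybe_value (x y x' y' : L) : Q :=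
  subst D2 (fun z => X z y y') (br x x')
  - subst D3 (fun z => X x z y') (br x' y)
  - subst D2 (fun z => X x x' z) (br y' y).

(* The digits give the factors of X that become the first, second and third
   argument; the operators are permuted in the same way. *)
Let XP213 := it_swap12 XP.
Let XP132 := it_swap23 XP.
Let XP231 := it_swap23 XP213.
Let XP321 := it_swap12 XP231.
Let XP312 := it_swap23 XP321.

(** The sum over (i, j) expands into twelve families of terms: for each way to
    place A and its dual in two of the three factors, one family with a product
    in A and one with the dual representation, which cancel by
    [canonical_slots12]. *)
Lemma cybe_value_canonical :
  \sum_i \sum_j
    (cybe_value (inA (e i)) (inV (es i)) (inA (e j)) (inV (es j))
     - cybe_value (inA (e i)) (inV (es i)) (inV (es j)) (inA (e j))
     - (cybe_value (inV (es i)) (inA (e i)) (inA (e j)) (inV (es j))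
        - cybe_value (inV (es i)) (inA (e i)) (inV (es j)) (inA (e j)))) = 0.
Proof.
pose a i := inA (e i); pose v i := inV (es i).
(* In P and R the product or the representation is that of e_i, so the sum
   over j alone cancels; some terms have the roles of i and j exchanged. *)
pose P1 i j := subst D2 (fun u => X (inA u) (v i) (v j)) (prod (e i) (e j)).
pose R1 i j := subst D2 (fun f => X (a j) (v i) (inV f)) (rho (e i) (es j)).
pose P2 i j := subst D3 (fun u => X (inA u) (v j) (v i)) (prod (e i) (e j)).
pose R2 i j := subst D3 (fun f => X (a j) (inV f) (v i)) (rho (e i) (es j)).
pose P3 i j := subst D3 (fun u => X (v j) (inA u) (v i)) (prod (e i) (e j)).
pose R3 i j := subst D3 (fun f => X (inV f) (a j) (v i)) (rho (e i) (es j)).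
pose P4 i j := subst D1 (fun u => X (v i) (inA u) (v j)) (prod (e i) (e j)).
pose R4 i j := subst D1 (fun f => X (v i) (a j) (inV f)) (rho (e i) (es j)).
pose P5 i j := subst D2 (fun u => X (v j) (v i) (inA u)) (prod (e i) (e j)).
pose R5 i j := subst D2 (fun f => X (inV f) (v i) (a j)) (rho (e i) (es j)).
pose P6 i j := subst D1 (fun u => X (v i) (v j) (inA u)) (prod (e i) (e j)).
pose R6 i j := subst D1 (fun f => X (v i) (inV f) (a j)) (rho (e i) (es j)).
pose S (F : 'I_n -> 'I_n -> Q) := \sum_i \sum_j F i j.
have SB F G : S (fun i j => F i j - G i j) = S F - S G.
  by rewrite /S -sumrB; apply: eq_bigr => i _; rewrite sumrB.
have SN F : S (fun i j => - F i j) = - S F.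
  by rewrite /S -sumrN; apply: eq_bigr => i _; rewrite sumrN.
have SC F : S (fun i j => F j i) = S F by rewrite /S exchange_big.
have SE F G : (forall i, \sum_j F i j = - \sum_j G i j) -> S G = - S F.
  by move=> FG; rewrite /S -sumrN; apply: eq_bigr => i _; rewrite FG opprK.
have E1 : S R1 = - S P1 by apply: SE => i; exact: canonical_slots12 XP132 _ _.
have E2 : S R2 = - S P2 by apply: SE => i; exact: canonical_slots12 XP _ _.
have E3 : S R3 = - S P3 by apply: SE => i; exact: canonical_slots12 XP213 _ _.
have E4 : S R4 = - S P4 by apply: SE => i; exact: canonical_slots12 XP231 _ _.
have E5 : S R5 = - S P5 by apply: SE => i; exact: canonical_slots12 XP312 _ _.
have E6 : S R6 = - S P6 by apply: SE => i; exact: canonical_slots12 XP321 _ _.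
transitivity (S (fun i j =>
  (P1 i j - P2 j i - R2 j i) - (R5 i j - R1 j i)
  - ((- R3 j i - (P3 j i - P4 i j) - - R4 i j)
     - (- - R6 i j - (P5 j i - P6 i j))))).
  apply: eq_bigr => i _; apply: eq_bigr => j _; rewrite /cybe_value.
  rewrite (bracketAA XP) (bracketAV XP) (bracketVA XP) (bracketVV XP).
  rewrite (bracketAA XP231) (bracketAV XP231) (bracketVA XP231) (bracketVV XP231).
  rewrite (bracketAA XP321) (bracketAV XP321) (bracketVA XP321) (bracketVV XP321).
  by rewrite !subr0 sub0r.
(* Abstract atoms keep the rewriting below from unfolding the sums. *)
clearbody P1 P2 P3 P4 P5 P6 R1 R2 R3 R4 R5 R6 S.
rewrite !SB !SN (SC P2) (SC R2) (SC R1) (SC R3) (SC P3) (SC P5).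
by rewrite E1 E2 E3 E4 E5 E6; exact: six_pairs_cancel.
Qed.

End CanonicalSolution.

End Slots.

(** * The quotient by the total derivative *)

Section Cokernel.
Variables (T : zmodType) (d : T -> T) (dB : zmod_morphism d).

Definition range_pred of zmod_morphism d : {pred T} :=
  fun t => `[< exists s, t = d s >].

Lemma range_zmod_closed : zmod_closed (range_pred dB).
Proof.
split=> [|x y]; rewrite /in_mem /=.
  by apply/asboolP; exists 0; rewrite zmod_morphism0.
by move=> /asboolP[s ->] /asboolP[s' ->]; apply/asboolP; exists (s - s'); rewrite dB.
Qed.

HB.instance Definition _ :=
  GRing.isZmodClosed.Build T (range_pred dB) range_zmod_closed.

Definition coker : Type := @Quotient.quot T (range_pred dB).
HB.instance Definition _ := GRing.Zmodule.on coker.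

Definition coproj (t : T) : coker := \pi_(@Quotient.quot T (range_pred dB))%qT t.

Lemma coprojB : zmod_morphism coproj.
Proof. exact: (raddfB \pi_(@Quotient.quot T (range_pred dB))%qT). Qed.

Lemma coproj_eq0 t : coproj t = 0 <-> exists s, t = d s.
Proof.
have /= E := @Quotient.idealrBE _ (range_pred dB) t 0.
have E0 : coproj 0 = 0 := zmod_morphism0 coprojB.
rewrite subr0 in E; split=> [h|h].
  apply/asboolP; have -> : `[< exists s, t = d s >] = (t \in range_pred dB) by [].
  by rewrite E; apply/eqP; rewrite -[LHS]/(coproj t) -[RHS]/(coproj 0) h E0.
rewrite -E0; apply/eqP; rewrite -[_ == _]E; exact/asboolP.
Qed.

Definition corep (t : coker) : T := repr (t : @Quotient.quot T (range_pred dB)).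
Lemma corepK : cancel corep coproj.
Proof. by move=> t; rewrite /coproj reprK. Qed.

Definition coker_op (D : T -> T) (t : coker) : coker := coproj (D (corep t)).

Lemma coker_opE D t : zmod_morphism D -> (forall s, D (d s) = d (D s)) ->
  coker_op D (coproj t) = coproj (D t).
Proof.
move=> DB Dd; apply/eqP; rewrite -subr_eq0 -coprojB -DB; apply/eqP/coproj_eq0.
have /coproj_eq0[s ->] : coproj (corep (coproj t) - t) = 0.
  by rewrite coprojB corepK subrr.
by exists (D s); rewrite Dd.
Qed.

End Cokernel.

(** Three commuting operators P1, P2, P3, as d1, d2, d3 on the tensor cube. They
    commute with their sum, so they descend to its cokernel, where their sum
    is 0. The cube enters only through these properties. *)
Section TotalQuotient.
Variables (T : zmodType) (P1 P2 P3 : T -> T).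
Hypotheses (P1B : zmod_morphism P1) (P2B : zmod_morphism P2).
Hypothesis P3B : zmod_morphism P3.
Hypotheses (C12 : forall t, P1 (P2 t) = P2 (P1 t)).
Hypotheses (C13 : forall t, P1 (P3 t) = P3 (P1 t)).
Hypotheses (C23 : forall t, P2 (P3 t) = P3 (P2 t)).

Lemma totalB : zmod_morphism (fun t => P1 t + P2 t + P3 t).
Proof.
move=> x y; rewrite P1B P2B P3B.
by rewrite (addrACA (P1 x)) (addrACA (P1 x + P2 x)) !opprD.
Qed.

Definition total_coker : zmodType := coker totalB.
Definition total_proj : T -> total_coker := coproj totalB.
Definition total_op (D : T -> T) : total_coker -> total_coker :=
  @coker_op _ _ totalB D.

Lemma total_projB : zmod_morphism total_proj.
Proof. exact: coprojB. Qed.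

Lemma total_proj_eq0 t : total_proj t = 0 <-> exists s, t = P1 s + P2 s + P3 s.
Proof. exact: coproj_eq0. Qed.

Lemma total_op1 t : total_op P1 (total_proj t) = total_proj (P1 t).
Proof.
by apply: coker_opE => // s; rewrite !(zmod_morphismD P1B) C12 C13.
Qed.

Lemma total_op2 t : total_op P2 (total_proj t) = total_proj (P2 t).
Proof.
by apply: coker_opE => // s; rewrite !(zmod_morphismD P2B) C12 C23.
Qed.

Lemma total_op3 t : total_op P3 (total_proj t) = total_proj (P3 t).
Proof.
by apply: coker_opE => // s; rewrite !(zmod_morphismD P3B) C13 C23.
Qed.

Let total_opB (D : T -> T) : zmod_morphism D ->
  (forall t, total_op D (total_proj t) = total_proj (D t)) ->
  zmod_morphism (total_op D).
Proof.
move=> DB DE x y; rewrite -[x]corepK -[y]corepK -/(total_proj _) -/(total_proj _).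
by rewrite -total_projB !DE DB total_projB.
Qed.

Lemma total_proj_subst (M : zmodType) (D : T -> T) (phi : M -> T) f :
  (forall t, total_op D (total_proj t) = total_proj (D t)) ->
  total_proj (subst D phi f) = subst (total_op D) (fun z => total_proj (phi z)) f.
Proof.
move=> DE; rewrite /subst (zmod_morphism_sum _ _ total_projB).
apply: eq_bigr => k _; move: (phi _) => t.
by elim: k => //= k <-; rewrite DE.
Qed.

Variables (K : fieldType) (L : lmodType {poly K}) (X : L -> L -> L -> T).
Hypothesis add1 : forall y z, zmod_morphism (fun x => X x y z).
Hypothesis add2 : forall x z, zmod_morphism (fun y => X x y z).
Hypothesis add3 : forall x y, zmod_morphism (fun z => X x y z).
Hypothesis scal12 : forall c x y z, X (c%:P *: x) y z = X x (c%:P *: y) z.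
Hypothesis scal23 : forall c x y z, X x (c%:P *: y) z = X x y (c%:P *: z).
Hypothesis X1 : forall x y z, X ('X *: x) y z = P1 (X x y z).
Hypothesis X2 : forall x y z, X x ('X *: y) z = P2 (X x y z).
Hypothesis X3 : forall x y z, X x y ('X *: z) = P3 (X x y z).

Lemma total_proj_invariant :
  invariant_trilinear (fun x y z => total_proj (X x y z))
    (total_op P1) (total_op P2) (total_op P3).
Proof.
have pB := total_projB.
have rep (t : total_coker) : exists s, t = total_proj s.
  by exists (corep t); rewrite /total_proj corepK.
split; try exact: total_opB total_op1; try exact: total_opB total_op2;
  try exact: total_opB total_op3.
- by move=> t; have [s ->] := rep t; rewrite !(total_op1, total_op2) C12.
- by move=> t; have [s ->] := rep t; rewrite !(total_op1, total_op3) C13.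
- by move=> t; have [s ->] := rep t; rewrite !(total_op2, total_op3) C23.
- move=> t; have [s ->] := rep t; rewrite total_op1 total_op2 total_op3.
  by rewrite -!(zmod_morphismD pB); apply/total_proj_eq0; exists s.
- by move=> y z u v; rewrite -pB add1.
- by move=> x z u v; rewrite -pB add2.
- by move=> x y u v; rewrite -pB add3.
- by move=> c x y z; rewrite scal12.
- by move=> c x y z; rewrite scal23.
- by move=> x y z; rewrite total_op1 X1.
- by move=> x y z; rewrite total_op2 X2.
- by move=> x y z; rewrite total_op3 X3.
Qed.

End TotalQuotient.

(** * The canonical tensor solves the equation *)

Lemma tensor_ext (K : fieldType) (U V W : lmodType K) (f g : tensor U V -> W) :
  linear f -> linear g -> (forall u v, f (tpure u v) = g (tpure u v)) -> f =1 g.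
Proof.
move=> fl gl fg t; rewrite -[t]treprK [trepr t]monalgE.
have pB : zmod_morphism (@tproj K U V) by move=> x y; exact: tprojB.
rewrite (zmod_morphism_sum _ _ pB) !zmod_morphism_sum; try exact: zmod_morphism_linear.
apply: eq_bigr => k _.
have -> : << (trepr t)@_k *g k >> = (trepr t)@_k *: tgen k.1 k.2.
  rewrite /tgen -surjective_pairing; apply/malgP => k'.
  by rewrite mcoeffZ !mcoeffU mulrnAr mulr1.
by rewrite tprojZ (scalable_linear fl) (scalable_linear gl) -/(tpure _ _) fg.
Qed.

Lemma morph_sum_diff (T Q : zmodType) (f : T -> Q) n (a b c d : 'I_n -> 'I_n -> T) :
  zmod_morphism f ->
  f (\sum_i \sum_j (a i j - b i j - (c i j - d i j)))
  = \sum_i \sum_j (f (a i j) - f (b i j) - (f (c i j) - f (d i j))).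
Proof.
move=> fB; rewrite (zmod_morphism_sum _ _ fB); apply: eq_bigr => i _.
rewrite (zmod_morphism_sum _ _ fB); apply: eq_bigr => j _.
by rewrite !fB.
Qed.

Section TensorCube.
Variables (K : fieldType) (L : lmodType {poly K}).
Local Notation tensor3 := (tensor (tensor (kspace L) (kspace L)) (kspace L)).

Lemma tens3_ext (W : lmodType K) (f g : tensor3 -> W) :
  linear f -> linear g ->
  (forall x y z : L, f (tens3 x y z) = g (tens3 x y z)) -> f =1 g.
Proof.
move=> fl gl fg; apply: tensor_ext => // t z.
have tl : linear (fun t : tensor (kspace L) (kspace L) => tpure t z).
  by move=> c x y; rewrite tpureDl tpureZl.
apply: (@tensor_ext _ _ _ _ (fun t => f (tpure t z)) (fun t => g (tpure t z))).
- by move=> c x y; rewrite tl fl.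
- by move=> c x y; rewrite tl gl.
- by move=> u v; exact: fg.
Qed.

Lemma comp_linear (U V W : lmodType K) (f : U -> V) (g : V -> W) :
  linear f -> linear g -> linear (fun x => g (f x)).
Proof. by move=> fl gl c x y; rewrite fl gl. Qed.

Let p1 := @partial1_linear K L.
Let p2 := @partial2_linear K L.
Let p3 := @partial3_linear K L.

Lemma partialC12 t : partial1 (@partial2 K L t) = partial2 (partial1 t).
Proof.
move: t; apply: (@tens3_ext _ (fun t => partial1 (partial2 t))
  (fun t => partial2 (partial1 t)) (comp_linear p2 p1) (comp_linear p1 p2)) => x y z.
have Eab := etrans (congr1 (@partial1 K L) (partial2E x y z)) (partial1E x ('X *: y) z).
have Eba := etrans (congr1 (@partial2 K L) (partial1E x y z)) (partial2E ('X *: x) y z).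
exact: etrans Eab (esym Eba).
Qed.

Lemma partialC13 t : partial1 (@partial3 K L t) = partial3 (partial1 t).
Proof.
move: t; apply: (@tens3_ext _ (fun t => partial1 (partial3 t))
  (fun t => partial3 (partial1 t)) (comp_linear p3 p1) (comp_linear p1 p3)) => x y z.
have Eab := etrans (congr1 (@partial1 K L) (partial3E x y z)) (partial1E x y ('X *: z)).
have Eba := etrans (congr1 (@partial3 K L) (partial1E x y z)) (partial3E ('X *: x) y z).
exact: etrans Eab (esym Eba).
Qed.

Lemma partialC23 t : partial2 (@partial3 K L t) = partial3 (partial2 t).
Proof.
move: t; apply: (@tens3_ext _ (fun t => partial2 (partial3 t))
  (fun t => partial3 (partial2 t)) (comp_linear p3 p2) (comp_linear p2 p3)) => x y z.
have Eab := etrans (congr1 (@partial2 K L) (partial3E x y z)) (partial2E x y ('X *: z)).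
have Eba := etrans (congr1 (@partial3 K L) (partial2E x y z)) (partial3E x ('X *: y) z).
exact: etrans Eab (esym Eba).
Qed.

Let p1B := zmod_morphism_linear p1.
Let p2B := zmod_morphism_linear p2.
Let p3B := zmod_morphism_linear p3.

Definition cube_proj := total_proj p1B p2B p3B.

Definition cube_op : (tensor3 -> tensor3) -> _ :=
  @total_op _ _ _ _ p1B p2B p3B.

Lemma cube_proj_eq0 t : cube_proj t = 0 ->
  exists s, t = partial1 s + partial2 s + partial3 s.
Proof. by move/total_proj_eq0. Qed.

Lemma tens3_invariant :
  invariant_trilinear (fun x y z : L => cube_proj (tens3 x y z))
    (cube_op (@partial1 K L)) (cube_op (@partial2 K L)) (cube_op (@partial3 K L)).
Proof.
apply: total_proj_invariant.
- exact: partialC12.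
- exact: partialC13.
- exact: partialC23.
- by move=> y z; exact: zmod_morphism_linear (tens3_linear1 y z).
- by move=> x z; exact: zmod_morphism_linear (tens3_linear2 x z).
- by move=> x y; exact: zmod_morphism_linear (tens3_linear3 x y).
- move=> c x y z; apply: etrans (scalable_linear (tens3_linear1 y z) c x) _.
  exact/esym/(scalable_linear (tens3_linear2 x z)).
- move=> c x y z; apply: etrans (scalable_linear (tens3_linear2 x z) c y) _.
  exact/esym/(scalable_linear (tens3_linear3 x y)).
- by move=> x y z; apply/esym/partial1E.
- by move=> x y z; apply/esym/partial2E.
- by move=> x y z; apply/esym/partial3E.
Qed.

Lemma cube_proj_cybe_form (br : L -> L -> lpoly L) x y x' y' :
  let Y x y z := cube_proj (tens3 x y z) in
  cube_proj (cybe_form br x y x' y')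
  = subst (cube_op (@partial2 K L)) (fun z => Y z y y') (br x x')
    - subst (cube_op (@partial3 K L)) (fun z => Y x z y') (br x' y)
    - subst (cube_op (@partial2 K L)) (fun z => Y x x' z) (br y' y).
Proof.
have S2 (phi : L -> tensor3) f : cube_proj (subst (@partial2 K L) phi f)
    = subst (cube_op (@partial2 K L)) (fun z => cube_proj (phi z)) f.
  apply: total_proj_subst => t; apply: total_op2; first exact: partialC12.
  exact: partialC23.
have S3 (phi : L -> tensor3) f : cube_proj (subst (@partial3 K L) phi f)
    = subst (cube_op (@partial3 K L)) (fun z => cube_proj (phi z)) f.
  apply: total_proj_subst => t; apply: total_op3; first exact: partialC13.
  exact: partialC23.
have pB : zmod_morphism cube_proj by exact: total_projB.
move=> Y; rewrite /cybe_form 2!pB.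
by congr (_ - _ - _); [exact: S2 | exact: S3 | exact: S2].
Qed.

(** For r = sum_i (x_i (x) y_i - y_i (x) x_i) and a bilinear bracket, it is
    enough that the expansion of the Yang-Baxter expression vanishes in the
    quotient. *)
Lemma skew_ccybe (br : L -> L -> lpoly L) n (x y : 'I_n -> L) :
  lambda_bilinear br ->
  \sum_i \sum_j
    (cube_proj (cybe_form br (x i) (y i) (x j) (y j))
     - cube_proj (cybe_form br (x i) (y i) (y j) (x j))
     - (cube_proj (cybe_form br (y i) (x i) (x j) (y j))
        - cube_proj (cybe_form br (y i) (x i) (y j) (x j)))) = 0 ->
  ccybe br (\sum_i (tens2 (x i) (y i) - tens2 (y i) (x i))).
Proof.
move=> brP sum0 m x' y' rE; rewrite (ccybe_lhsE brP rE).
apply: cube_proj_eq0; rewrite (cybe_bilin_skew brP).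
have pB : zmod_morphism cube_proj by exact: total_projB.
pose F i j := cybe_form br (x i) (y i) (x j) (y j).
pose G i j := cybe_form br (x i) (y i) (y j) (x j).
pose F' i j := cybe_form br (y i) (x i) (x j) (y j).
pose G' i j := cybe_form br (y i) (x i) (y j) (x j).
exact: etrans (morph_sum_diff F G F' G' pB) sum0.
Qed.

End TensorCube.

Theorem canonical_ccybe (K : fieldType) (A : lmodType {poly K})
    (prod : A -> A -> lpoly A) (Aprod : left_symmetric_conformal prod)
    (n : nat) (e : 'I_n -> A) (e_basis : module_basis e)
    (es : 'I_n -> cdual A) (es_dual : dual_family e es) :
  ccybe (semidirect (subadjacent prod) (dual_regular prod))
    (\sum_i (tens2 (e i, 0) (0, es i) - tens2 (0, es i) (e i, 0))).
Proof.
have rhoP := dual_regular_bilinear Aprod e_basis.1.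
have brP := semidirect_bilinear (subadjacent_bilinear (lsc_bilinear Aprod)) rhoP.
apply: (skew_ccybe brP).
apply: etrans (cybe_value_canonical Aprod e_basis es_dual (@tens3_invariant _ _)).
apply: eq_bigr => i _; apply: eq_bigr => j _.
by congr (_ - _ - (_ - _)); exact: cube_proj_cybe_form.
Qed.

Theorem theorem4p2 (R : realType) (A : lmodType {poly R[i]})
    (prod : A -> A -> lpoly A) (Aprod : left_symmetric_conformal prod)
    (n : nat) (e : 'I_n -> A) (e_basis : module_basis e)
    (es : 'I_n -> cdual A) (es_dual : dual_family e es) :
  ccybe (semidirect (subadjacent prod) (dual_regular prod))
    (\sum_i (tens2 (e i, 0) (0, es i) - tens2 (0, es i) (e i, 0))).
Proof. exact: canonical_ccybe. Qed.
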